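(* Let $\mathbb{F}$ be a field of characteristic $2$, let $n\ge1$, let $\Delta$ be an $\mathbb{F}$-homology $(2n-1)$-sphere, and suppose that $\Delta'$ is obtained from $\Delta$ via a bistellar $q$-move (for some $0\le q\le 2n-1$). Then $\Delta$ is generically anisotropic over $\mathbb{F}$ if and only if $\Delta'$ is generically anisotropic over $\mathbb{F}$.
   Context: Homology spheres: for a field $\mathbb{F}$, a finite simplicial complex $\Delta$ is an $\mathbb{F}$-homology $d$-sphere if for every face $\sigma\in\Delta$ (including $\sigma=\emptyset$) the link $\mathrm{lk}_\sigma\Delta=\{\tau\in\Delta:\tau\cup\sigma\in\Delta,\ \tau\cap\sigma=\emptyset\}$ has the same homology with coefficients in $\mathbb{F}$ as the sphere $S^{d-|\sigma|}$, where $|\sigma|$ is the number of vertices of $\sigma$ (with $S^{-1}=\emptyset$, and the complex $\{\emptyset\}$ regarded as a $(-1)$-sphere). Bistellar moves: for a finite set $\sigma$, $\partial\sigma$ denotes the complex of all proper subsets of $\sigma$; the symbol $\sigma$ also denotes the full simplex of all subsets of $\sigma$. The star of a face is $\mathrm{st}_\sigma\Delta=\{\tau\in\Delta:\tau\cup\sigma\in\Delta\}$, and the join of complexes on disjoint vertex sets is $\Delta_1*\Delta_2=\{\sigma_1\cup\sigma_2:\sigma_1\in\Delta_1,\ \sigma_2\in\Delta_2\}$. Let $\Delta$ be a pure simplicial complex of dimension $d$, and let $\sigma\in\Delta$ be a $(d-q)$-dimensional face such that $\mathrm{lk}_\sigma\Delta=\partial\tau$ for a set $\tau$ of $q+1$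 elements that is not a face of $\Delta$; for $q\ge1$, $\tau$ consists of vertices of $\Delta$, while for $q=0$, $\sigma$ is a facet and $\tau$ is a single new vertex not in $\Delta$. The operation $\chi_\sigma\Delta=(\Delta\setminus\mathrm{st}_\sigma\Delta)\cup(\partial\sigma*\tau)$ is called a bistellar $q$-move. Face rings: for a field $K$ and a simplicial complex $\Delta$ with vertex set $[m]=\{1,\dots,m\}$, the face ring is $K[\Delta]=K[x_1,\dots,x_m]/I_\Delta$, graded by $\deg x_i=1$, where $I_\Delta$ is generated by the monomials $x_{i_1}\cdots x_{i_k}$ with $\{i_1,\dots,i_k\}\notin\Delta$. If $\dim\Delta=d-1$, a linear system of parameters (l.s.o.p.) for $K[\Delta]$ is a sequence $\Theta=(\theta_1,\dots,\theta_d)$ of $d$ linear forms such that the Artinian reduction $K(\Delta;\Theta):=K[\Delta]/(\Theta)$ is a finite-dimensional $K$-vector space; $K(\Delta;\Theta)_i$ denotes its degree $i$ component. Anisotropy: for a homology $(d-1)$-sphere $\Delta$, an Artinian reduction $K(\Delta;\Theta)$ is anisotropic if for every $i\le d/2$ and every nonzero $u\in K(\Delta;\Theta)_i$, the square $u^2$ is nonzero in $K(\Delta;\Theta)_{2i}$. An $\mathbb{F}$-homology $(d-1)$-sphere $\Delta$ with vertex set identified with $[m]$ is generically anisotropic over $\mathbb{F}$ if $\mathbf{k}(\Delta;\Theta)$ is anisotropic, where $\mathbf{k}=\mathbb{F}(a_{ij}:1\le i\le d,\ 1\le j\le m)$ is the field of rational functions in independent variables $a_{ij}$ and $\Theta=(\theta_1,\dots,\theta_d)$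 with $\theta_i=\sum_{j=1}^m a_{ij}x_j$ (this $\Theta$ is an l.s.o.p. for $\mathbf{k}[\Delta]$). *)

(* Defs.v *)
From HB Require Import structures.
From mathcomp Require Import all_boot all_order all_algebra.
From mathcomp Require Import fraction.
From mathcomp.multinomials Require Import mpoly.

Set Implicit Arguments.
Unset Strict Implicit.
Unset Printing Implicit Defensive.

Import GRing.Theory.
Local Open Scope ring_scope.

Section SimplicialComplexes.
Variable T : finType.
Implicit Types (D A B : {set {set T}}) (s t u : {set T}).

(* The elements of the ambient type T need not all be vertices. *)
Definition simplicial_complex D : Prop :=
  set0 \in D /\ forall s t, s \in D -> t \subset s -> t \in D.

Definition vertices D : {set T} := [set v | [set v] \in D].

Definition link D s : {set {set T}} :=
  [set t in D | (t :|: s \in D) && (t :&: s == set0)].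

Definition star D s : {set {set T}} := [set t in D | t :|: s \in D].

Definition simplex_boundary s : {set {set T}} := [set u : {set T} | u \proper s].

Definition join A B : {set {set T}} := [set u :|: v | u in A, v in B].

(* All facets have d.+1 vertices, i.e. dimension d. *)
Definition pure_of_dim (d : nat) D : Prop :=
  simplicial_complex D /\
  forall s, maxset [pred u | u \in D] s -> #|s| = d.+1.

(* The complex \chi_s D; here powerset t is the full simplex on t. *)
Definition bistellar_flip D s t : {set {set T}} :=
  (D :\: star D s) :|: join (simplex_boundary s) (powerset t).

Record is_bistellar_move (d q : nat) D s t : Prop := IsBistellarMove {
  bm_pure : pure_of_dim d D;
  bm_face : s \in D;
  bm_card_face : (#|s| + q)%N = d.+1;
  bm_card_new : #|t| = q.+1;
  bm_link : link D s = simplex_boundary t;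
  bm_nonface : t \notin D;
  bm_vertices : if q == 0%N then [disjoint t & vertices D]
                else t \subset vertices D }.

Definition bistellar_move (d q : nat) D D' : Prop :=
  exists s t, is_bistellar_move d q D s t /\ D' = bistellar_flip D s t.

End SimplicialComplexes.

Section Homology.
Variables (F : fieldType) (T : finType).
Implicit Types (D : {set {set T}}) (s t : {set T}).

(* Chains are the F-valued functions on all finite subsets of T; faces are    *)
(* oriented by the order of enum_rank.  The coefficient at t of the boundary  *)
(* of f collects the values of f at the sets v |: t of which t is a facet.    *)
Definition chain_boundary (f : {ffun {set T} -> F^o}) : {ffun {set T} -> F^o} :=
  [ffun t : {set T} => \sum_(v | v \notin t)
     (-1) ^+ #|[set w in t | (enum_rank w < enum_rank v)%N]| *: f (v |: t)].

Lemma chain_boundary_is_linear : linear chain_boundary.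
Proof.
move=> a f g; apply/ffunP=> t; rewrite !ffunE /= scaler_sumr -big_split /=.
by apply: eq_bigr => v _; rewrite !ffunE /= scalerDr !scalerA [_ * a]mulrC.
Qed.

HB.instance Definition _ :=
  GRing.isLinear.Build F {ffun {set T} -> F^o} {ffun {set T} -> F^o} *:%R
    chain_boundary chain_boundary_is_linear.

Definition elementary_chain s : {ffun {set T} -> F^o} :=
  [ffun t : {set T} => (t == s)%:R].

(* Chain spaces are indexed by the number k of vertices of a face, so that    *)
(* chains D k is the space of chains of dimension k - 1; the empty face gives *)
(* the augmentation, hence reduced homology.                                  *)
Definition chains D (k : nat) : {vspace {ffun {set T} -> F^o}} :=
  <<[seq elementary_chain s | s <- enum D & #|s| == k]>>%VS.

Definition cycles D (k : nat) : {vspace {ffun {set T} -> F^o}} :=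
  (chains D k :&: lker (linfun chain_boundary))%VS.

Definition boundaries D (k : nat) : {vspace {ffun {set T} -> F^o}} :=
  (linfun chain_boundary @: chains D k.+1)%VS.

(* The dimension of the reduced homology of D in degree k - 1. *)
Definition reduced_betti D (k : nat) : nat :=
  (\dim (cycles D k) - \dim (boundaries D k))%N.

(* The reduced homology of the sphere S^e over F is F in degree e and zero in *)
(* all other degrees, including for e = -1; here e = d - #|s| and the degree  *)
(* is k - 1.  In particular no face has more than d.+1 vertices.              *)
Definition homology_sphere (d : nat) D : Prop :=
  simplicial_complex D /\
  forall s, s \in D -> forall k : nat,
    reduced_betti (link D s) k = ((k + #|s|)%N == d.+1).

End Homology.

Section ArtinianReductions.
Variables (K : fieldType) (m : nat).
Implicit Types (D : {set {set 'I_m}}) (p : {mpoly K[m]}).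

(* p is zero in the face ring K[D]. *)
Definition face_ideal D p : Prop :=
  exists c : {set 'I_m} -> {mpoly K[m]},
    p = \sum_(s : {set 'I_m} | s \notin D) c s * \prod_(j in s) 'X_j.

(* p is zero in K(D; theta) = K[D] / (theta). *)
Definition reduction_ideal (d : nat) D (theta : 'I_d -> {mpoly K[m]}) p : Prop :=
  exists b : 'I_d -> {mpoly K[m]}, face_ideal D (p - \sum_i b i * theta i).

(* The degree i component of K(D; theta) consists of the classes of the       *)
(* homogeneous polynomials of degree i.                                       *)
Definition anisotropic (d : nat) D (theta : 'I_d -> {mpoly K[m]}) : Prop :=
  forall (i : nat) p, (2 * i <= d)%N -> p \is i.-homog ->
    ~ reduction_ideal D theta p -> ~ reduction_ideal D theta (p ^+ 2).

End ArtinianReductions.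

Section GenericAnisotropy.
Variables (F : fieldType) (T : finType) (d : nat) (D : {set {set T}}).

Let m := #|vertices D|.

Definition relabel : {set {set 'I_m}} :=
  [set s : {set 'I_m} | [set enum_val j | j in s] \in D].

Definition generic_field : fieldType := {fraction {mpoly F[d * m]}}.

Definition generic_coef (i : 'I_d) (j : 'I_m) : generic_field :=
  FracField.tofrac ('X_(mxvec_index i j) : {mpoly F[d * m]}).

Definition generic_theta (i : 'I_d) : {mpoly generic_field[m]} :=
  \sum_(j < m) generic_coef i j *: 'X_j.

(* Meant for complexes D of dimension d - 1. *)
Definition generically_anisotropic : Prop := anisotropic relabel generic_theta.

End GenericAnisotropy.

(* Main.v *)
Require Import Defs.
From HB Require Import structures.
From mathcomp Require Import all_boot all_order all_algebra.
From mathcomp Require Import fingroup perm fraction ring generic_quotient.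
From mathcomp.multinomials Require Import ssrcomplements mpoly.
From Stdlib Require Import Classical.

(** Let [d = 2 * n]. The proof passes through a weak form of Poincare duality:
    a complex is nondegenerate in degree [i] when a class of degree [i] of the
    Artinian reduction is zero as soon as its products with all classes of degree
    [d - i] are zero ([nondegenerate_in]). In characteristic 2 and for generic
    parameters, anisotropy is the same as nondegeneracy in the degrees from 1 to
    [n], and nondegeneracy is an assertion of linear algebra that can be followed
    through a flip.

    From anisotropy to nondegeneracy ([anisotropic_nondegenerate]): a class of
    positive degree which is killed by all variables has square zero, so a nonzero
    class of degree [i] has a nonzero multiple in degree [n], and the square of
    this multiple is a nonzero multiple of the given class in degree [d].

    From nondegeneracy to anisotropy ([nondegenerate_anisotropic]): let [psi] be a
    linear functional that kills the ideal of the reduction. Its composite with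
    the trace of the Frobenius map kills the product of all the parameters times
    the ideal, because that product turns each parameter occurring in a member of
    the ideal into a square. If [u ^+ 2] is in the ideal, then expanding the product
    of the parameters gives a vanishing sum of products of matrix entries, one
    from each row, with coefficients [psi (u * 'X_[L]) ^+ 2]. For a generic matrix
    such products are linearly independent over the squares
    ([generic_square_independent]), so all products of [u] with monomials of
    degree [d - i] are killed by every [psi], hence are zero, and [u] is zero by
    nondegeneracy.

    Nondegeneracy under a flip ([nondegenerate_flip]): the flip exchanges a face
    [s] for a face [t], and the [d.+1] vertices of both carry exactly one linear
    dependency between their columns. Evaluation of polynomials at this
    dependency kills the parameters and is, in each degree, a coordinate on the
    ideal generated by [s] in the reduction of [D], and on the one generated by
    [t] in the reduction of [D']; each of them is at most a line
    ([star_class_mod], [flip_ideal]). The pairings of [D] and [D'] therefore differ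
    by an explicit form of rank one, and nondegeneracy can be transferred once the
    top class of [s] is known not to vanish.

    This nonvanishing comes from homology. In a homology sphere every ridge lies
    in exactly two facets, so in an even number of them ([card_ridge]): the sum of
    all facets is a cycle modulo 2, and Lee's formula for the degree map defines a
    functional which kills the ideal but not the facets
    ([facet_notin_reduction]). By the symmetry of the flip the top class of [t]
    does not vanish in the reduction of [D'] either ([top_class_flip]).

    The vertex sets of [D] and [D'], hence their fields of coefficients, may
    differ by one vertex. The comparison takes place over the field of one larger
    generic matrix, using that ranks are invariant under field extensions
    ([nondegenerate_field_extension], [reduction_field_extension]). *)

Set Implicit Arguments.
Unset Strict Implicit.
Unset Printing Implicit Defensive.

Import GRing.Theory.
Local Open Scope ring_scope.

(** * Monomials, linear forms and the ideal of an Artinian reduction *)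

Definition mnm_support m (M : 'X_{1..m}) : {set 'I_m} := [set j | M j != 0%N].

Definition squarefree_mnm m (s : {set 'I_m}) : 'X_{1..m} :=
  [multinom (j \in s : nat) | j < m].

Definition linear_form (K : fieldType) m (c : 'I_m -> K) : {mpoly K[m]} :=
  \sum_(j < m) c j *: 'X_j.

Definition matrix_forms (K : fieldType) d m (a : 'M[K]_(d, m)) (i : 'I_d) :
  {mpoly K[m]} := linear_form (a i).

Definition down_closed (T : finType) (D : {set {set T}}) : Prop :=
  forall s t : {set T}, s \in D -> t \subset s -> t \in D.

Section Monomials.
Variables (K : fieldType) (m : nat).
Implicit Types (M L : 'X_{1..m}) (s t : {set 'I_m}).

Lemma mnm_supportD M L : mnm_support (M + L)%MM = mnm_support M :|: mnm_support L.
Proof. by apply/setP=> j; rewrite !inE mnmDE addn_eq0 negb_and. Qed.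

Lemma mnm_supportU (j : 'I_m) : mnm_support U_(j)%MM = [set j].
Proof. by apply/setP=> k; rewrite !inE mnm1E [k == j]eq_sym; case: (j == k). Qed.

Lemma mnm_support_squarefree s : mnm_support (squarefree_mnm s) = s.
Proof. by apply/setP=> j; rewrite !inE mnmE; case: (j \in s). Qed.

Lemma mdeg_squarefree s : mdeg (squarefree_mnm s) = #|s|.
Proof.
rewrite mdegE -sum1_card [RHS]big_mkcond; apply: eq_bigr => j _.
by rewrite mnmE; case: (j \in s).
Qed.

Lemma prod_vars_squarefree s :
  \prod_(j in s) 'X_j = 'X_[squarefree_mnm s] :> {mpoly K[m]}.
Proof.
rewrite mpolyXE_id [LHS]big_mkcond; apply: eq_bigr => j _.
by rewrite mnmE; case: (j \in s); rewrite ?expr1 ?expr0.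
Qed.

Lemma squarefree_le s M : s \subset mnm_support M -> (squarefree_mnm s <= M)%MM.
Proof.
move/subsetP=> sM; apply/mnm_lepP=> j; rewrite mnmE.
by case: (boolP (j \in s)) => //= /sM; rewrite inE lt0n.
Qed.

Lemma card_mnm_support M : (#|mnm_support M| <= mdeg M)%N.
Proof.
rewrite mdegE -sum1_card big_mkcond; apply: leq_sum => j _.
by rewrite inE; case: (M j).
Qed.

Lemma mdeg_split M i : (i <= mdeg M)%N ->
  exists L, exists L', M = (L + L')%MM /\ mdeg L = i.
Proof.
elim: i M => [|i IH] M; first by exists 0%MM, M; rewrite add0m mdeg0.
move=> iM; have: mdeg M != 0%N by rewrite -lt0n; apply: leq_trans iM.
rewrite mdeg_eq0 => nzM.
have [j Mj] : exists j, M j != 0%N.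
  apply/existsP; apply: contraR nzM; rewrite negb_exists => /forallP z.
  by apply/eqP/mnmP=> j; rewrite mnm0E; apply/eqP; rewrite -[_ == _]negbK z.
have UM : (U_(j) <= M)%MM by rewrite lep1mP.
have defM : M = (U_(j) + (M - U_(j)))%MM by rewrite addmC submK.
have [|L [L' [defL dL]]] := IH (M - U_(j))%MM.
  by move: iM; rewrite {1}defM mdegD mdeg1.
exists (U_(j) + L)%MM, L'; rewrite -addmA -defL -defM; split=> //.
by rewrite mdegD mdeg1 dL.
Qed.

Lemma mdeg_neq0_factor M : mdeg M != 0%N -> exists j M', M = (U_(j) + M')%MM.
Proof.
rewrite -lt0n => /mdeg_split[L [M' [defM /eqP/mdeg1P[j /eqP defL]]]].
by exists j, M'; rewrite defM defL.
Qed.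

Lemma linear_form_homog (c : 'I_m -> K) : linear_form c \is 1.-homog.
Proof.
by apply: rpred_sum => j _; apply: rpredZ; rewrite dhomogX; apply/eqP/mdeg1.
Qed.

Lemma meval_linear_form (c x : 'I_m -> K) :
  (linear_form c).@[x] = \sum_j c j * x j.
Proof.
by rewrite raddf_sum; apply: eq_bigr => j _; rewrite /= mevalZ mevalXU.
Qed.

Lemma linear_form_comb d (a : 'M[K]_(d, m)) (c : 'rV_d) :
  \sum_l c 0 l *: matrix_forms a l = linear_form (fun j => (c *m a) 0 j).
Proof.
rewrite /linear_form; under eq_bigr do rewrite scaler_sumr.
rewrite exchange_big; apply: eq_bigr => j _; rewrite mxE scaler_suml.
by apply: eq_bigr => l _; rewrite scalerA.
Qed.

Lemma homog_ind i (P : {mpoly K[m]} -> Prop) :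
  P 0 -> (forall p q, P p -> P q -> P (p + q)) ->
  (forall c M, mdeg M = i -> P (c *: 'X_[M])) ->
  forall p, p \is i.-homog -> P p.
Proof.
move=> P0 PD PX p /dhomogP hp; rewrite (mpolyE p).
rewrite big_seq; elim/big_ind: _ => // M /hp; exact: PX.
Qed.

End Monomials.

Section ReductionIdeal.
Variables (K : fieldType) (m d : nat) (D : {set {set 'I_m}}).
Variable theta : 'I_d -> {mpoly K[m]}.
Implicit Types (p q : {mpoly K[m]}) (M L : 'X_{1..m}) (s : {set 'I_m}).
Local Notation I := (reduction_ideal D theta).

Lemma reduction0 : I 0.
Proof.
exists (fun=> 0); exists (fun=> 0).
by rewrite !big1 ?subrr // => *; rewrite mul0r.
Qed.

Lemma reductionD p q : I p -> I q -> I (p + q).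
Proof.
move=> [b [c E]] [b' [c' E']].
exists (fun i => b i + b' i); exists (fun s => c s + c' s).
under [RHS]eq_bigr do rewrite mulrDl.
rewrite [X in _ - X = _](eq_bigr (fun i => b i * theta i + b' i * theta i))
  => [|*]; last exact: mulrDl.
by rewrite !big_split /= -E -E' opprD addrACA.
Qed.

Lemma reductionMl q p : I p -> I (q * p).
Proof.
move=> [b [c E]]; exists (fun i => q * b i); exists (fun s => q * c s).
under [RHS]eq_bigr do rewrite -mulrA.
rewrite [X in _ - X = _](eq_bigr (fun i => q * (b i * theta i)))
  => [|*]; last exact/esym/mulrA.
by rewrite -!mulr_sumr -E mulrBr.
Qed.

Lemma reductionMr q p : I p -> I (p * q).
Proof. by rewrite mulrC; apply: reductionMl. Qed.

Lemma reductionZ c p : I p -> I (c *: p).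
Proof. by rewrite -mul_mpolyC; apply: reductionMl. Qed.

Lemma reductionN p : I p -> I (- p).
Proof. by rewrite -scaleN1r; apply: reductionZ. Qed.

Lemma reductionB p q : I p -> I q -> I (p - q).
Proof. by move=> Ip Iq; apply: reductionD Ip (reductionN Iq). Qed.

Lemma reduction_sum J (r : seq J) (P : pred J) (f : J -> {mpoly K[m]}) :
  (forall j, P j -> I (f j)) -> I (\sum_(j <- r | P j) f j).
Proof. move=> If; elim/big_ind: _ => //; [exact: reduction0|exact: reductionD]. Qed.

Lemma reduction_theta l : I (theta l).
Proof.
exists (fun i => (i == l)%:R); exists (fun=> 0).
rewrite [RHS]big1 => [|*]; last by rewrite mul0r.
rewrite (bigD1 l) //= eqxx mul1r big1 ?addr0 ?subrr // => i /negbTE->.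
by rewrite mul0r.
Qed.

Lemma reduction_nonface s M : s \notin D -> s \subset mnm_support M -> I 'X_[M].
Proof.
move=> sD /squarefree_le sM; exists (fun=> 0).
exists (fun t => if t == s then 'X_[M - squarefree_mnm s] else 0).
rewrite big1 => [|*]; last by rewrite mul0r.
rewrite subr0 (bigD1 s) //= eqxx [X in _ + X]big1 => [|t /andP[_ /negPf ->]].
  by rewrite addr0 prod_vars_squarefree -mpolyXD submK.
by rewrite mul0r.
Qed.

(** The ideal is graded: its part of degree [j] is spanned by the multiples of
    the parameters and the monomials of degree [j] with non-face support. This
    induction principle is how all functionals below are shown to vanish on the
    ideal. *)
Lemma reduction_graded_ind j (P : {mpoly K[m]} -> Prop) :
  down_closed D ->
  (forall l, theta l \is 1.-homog) ->
  P 0 -> (forall p q, P p -> P q -> P (p + q)) ->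
  (forall c M l, (mdeg M).+1 = j -> P (c *: ('X_[M] * theta l))) ->
  (forall c M, mdeg M = j -> mnm_support M \notin D -> P (c *: 'X_[M])) ->
  forall p, I p -> P (pihomog mdeg j p).
Proof.
move=> Dc th1 P0 PD Pth Pnf p [b [c /eqP]]; rewrite subr_eq => /eqP->.
have homX M q i : q \is i.-homog ->
    pihomog mdeg j ('X_[M] * q) = if (mdeg M + i == j)%N then 'X_[M] * q else 0.
  move=> hq; have hMq: 'X_[M] * q \is (mdeg M + i).-homog.
    by apply: dhomogM => //; rewrite dhomogX.
  case: eqP => [<-|/eqP ne]; first exact: pihomog_dE.
  exact: pihomog_ne0 ne hMq.
rewrite raddfD !raddf_sum /=; apply: (PD); elim/big_ind: _ => //.
- move=> s sD; rewrite (mpolyE (c s)) mulr_suml raddf_sum /=.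
  elim/big_ind: _ => // M _; rewrite -scalerAl linearZ prod_vars_squarefree /=.
  rewrite (homX _ _ #|s|); last by rewrite dhomogX /= mdeg_squarefree.
  case: eqP => [dM|_]; last by rewrite scaler0.
  rewrite -mpolyXD; apply: Pnf; first by rewrite mdegD mdeg_squarefree.
  apply: contra sD => /Dc; apply.
  by rewrite mnm_supportD mnm_support_squarefree subsetUr.
- move=> l _; rewrite (mpolyE (b l)) mulr_suml raddf_sum /=.
  elim/big_ind: _ => // M _; rewrite -scalerAl linearZ /= (homX _ _ _ (th1 l)).
  by rewrite addn1; case: eqP => [dM|_]; [apply: Pth | rewrite scaler0].
Qed.

Lemma reduction_homog_ind j (P : {mpoly K[m]} -> Prop) :
  down_closed D ->
  (forall l, theta l \is 1.-homog) ->
  P 0 -> (forall p q, P p -> P q -> P (p + q)) ->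
  (forall c M l, (mdeg M).+1 = j -> P (c *: ('X_[M] * theta l))) ->
  (forall c M, mdeg M = j -> mnm_support M \notin D -> P (c *: 'X_[M])) ->
  forall p, p \is j.-homog -> I p -> P p.
Proof.
move=> Dc th1 P0 PD Pth Pnf p hp Ip; rewrite -(pihomog_dE hp).
exact: reduction_graded_ind.
Qed.

End ReductionIdeal.

(** The half of Poincare duality that matters for anisotropy. It is formulated
    without a degree map, in terms of membership in the ideal, which can be
    compared along field extensions, relabellings and flips. *)
Definition nondegenerate_in (K : fieldType) m d (D : {set {set 'I_m}})
    (theta : 'I_d -> {mpoly K[m]}) (i : nat) : Prop :=
  forall u, u \is i.-homog ->
    (forall v, v \is (d - i).-homog -> reduction_ideal D theta (u * v)) ->
    reduction_ideal D theta u.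

(** * Nondegeneracy under bistellar flips *)

(** What the algebra below needs to know about a flip which trades the face [s]
    of [D] for the face [t] of [D']. The inverse flip satisfies the same
    conditions with [D], [s] and [D'], [t] exchanged, which makes every statement
    of this part available in both directions. *)
Record half_flip (T : finType) (D D' : {set {set T}}) (s t : {set T}) : Prop :=
  HalfFlip {
    hf_closed : down_closed D;
    hf_new : t \notin D;
    hf_link : forall v, v \notin s :|: t -> v |: s \notin D;
    hf_outside : forall u : {set T}, u \notin D' -> ~~ (s \subset u) ->
      (u \notin D) && ~~ (u \subset s :|: t) }.

(** [lam] is the linear dependency between the columns of [a] indexed by the
    [d.+1] vertices of the flip. As a point it lies on all the hyperplanes of the
    parameters, so that evaluation at [lam] kills the parameters; it is the
    degree map of the boundary of the simplex on [A], up to a scalar. *)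
Section Dependency.
Variables (K : fieldType) (m d : nat) (a : 'M[K]_(d, m)).
Variables (A : {set 'I_m}) (lam : 'I_m -> K).
Hypothesis lam_out : forall v, v \notin A -> lam v = 0.
Hypothesis lam_in : forall v, v \in A -> lam v != 0.
Hypothesis lam_dep : forall l, \sum_j a l j * lam j = 0.
Hypothesis dual_form : forall v w, v \in A -> w \in A -> v != w ->
  exists c : 'rV_d, (c *m a) 0 v = 1 /\
    forall u, u \in A -> u != v -> u != w -> (c *m a) 0 u = 0.
Variable v0 : 'I_m.
Hypothesis Av0 : v0 \in A.
Local Notation theta := (matrix_forms a).

Lemma meval_theta l : (theta l).@[lam] = 0.
Proof. by rewrite meval_linear_form lam_dep. Qed.

Lemma mevalX_out (M : 'X_{1..m}) :
  ~~ (mnm_support M \subset A) -> 'X_[M].@[lam] = 0.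
Proof.
case/subsetPn=> v; rewrite inE => Mv /lam_out v0'.
by rewrite mevalX (bigD1 v) //= v0' expr0n (negPf Mv) mul0r.
Qed.

Lemma mevalX_in (M : 'X_{1..m}) :
  mnm_support M \subset A -> 'X_[M].@[lam] != 0.
Proof.
move/subsetP=> MA; rewrite mevalX; apply/prodf_neq0 => v _.
case: (eqVneq (M v) 0%N) => [->|Mv]; first by rewrite expr0 oner_neq0.
by rewrite expf_neq0 // lam_in // MA // inE.
Qed.

Section OneSide.
Variables (D : {set {set 'I_m}}) (s : {set 'I_m}).
Hypothesis sA : s \subset A.
Hypothesis link : forall v, v \notin A -> v |: s \notin D.
Local Notation I := (reduction_ideal D theta).

(** A multiple of the monomial of [s] in degree [j]; any monomial with support
    between [s] and [A] would do, by [star_class_mod]. *)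
Definition star_mnm (j : nat) : 'X_{1..m} :=
  (squarefree_mnm s + U_(v0) *+ (j - #|s|))%MM.

Definition star_class (j : nat) : {mpoly K[m]} :=
  ('X_[star_mnm j].@[lam])^-1 *: 'X_[star_mnm j].

Lemma mdeg_star_mnm j : (#|s| <= j)%N -> mdeg (star_mnm j) = j.
Proof. by move=> sj; rewrite mdegD mdegMn mdeg1 mul1n mdeg_squarefree subnKC. Qed.

Lemma star_class_homog j : (#|s| <= j)%N -> star_class j \is j.-homog.
Proof. by move=> sj; rewrite rpredZ // dhomogX /= mdeg_star_mnm. Qed.

Lemma star_mnm_support j : s \subset mnm_support (star_mnm j) /\
  mnm_support (star_mnm j) \subset A.
Proof.
rewrite mnm_supportD mnm_support_squarefree subsetUl subUset sA; split=> //=.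
apply/subsetP=> v; rewrite inE mulmnE mnm1E muln_eq0 negb_or eqb0 negbK.
by case/andP=> /eqP<-.
Qed.

Lemma meval_star_class j : (star_class j).@[lam] = 1.
Proof.
by rewrite mevalZ mulVf // mevalX_in //; case: (star_mnm_support j).
Qed.

Local Notation xs := ('X_[squarefree_mnm s] : {mpoly K[m]}).
Local Notation y := ((lam v0)^-1 *: 'X_v0 : {mpoly K[m]}).

(** All the variables act on the class of [s] through one and the same variable:
    the parameter that vanishes at the columns of [A] other than [v] and [v0]
    relates [v] to [v0] and to variables outside the star of [s]. *)
Lemma star_var v : I (xs * 'X_v - lam v *: (xs * y)).
Proof.
have out u : u \notin A -> I (xs * 'X_u).
  move=> /link uD; rewrite -mpolyXD; apply: (reduction_nonface _ uD).
  by rewrite mnm_supportD mnm_support_squarefree mnm_supportU setUC.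
case: (boolP (v \in A)) => [Av|Av]; last first.
  by rewrite lam_out // scale0r subr0; apply: out.
case: (eqVneq v v0) => [->|vv0].
  by rewrite -scalerAr scalerA mulfV ?lam_in // scale1r subrr; apply: reduction0.
have [c [cv cu]] := dual_form Av Av0 vv0.
have cv0 : (c *m a) 0 v0 = - (lam v / lam v0).
  have: \sum_j (c *m a) 0 j * lam j = 0.
    under eq_bigr do rewrite mxE mulr_suml.
    rewrite exchange_big big1 //= => l _; under eq_bigr do rewrite -mulrA.
    by rewrite -mulr_sumr lam_dep mulr0.
  rewrite (bigD1 v) //= (bigD1 v0) 1?eq_sym //= big1 => [|u /andP[uv uv0]].
    rewrite cv mul1r addr0 => /eqP; rewrite addrC addr_eq0 => /eqP E.
    by rewrite -mulNr -E mulfK // lam_in.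
  case: (boolP (u \in A)) => [Au|/lam_out->]; last by rewrite mulr0.
  by rewrite cu ?mul0r.
have -> : xs * 'X_v - lam v *: (xs * y) =
    xs * linear_form (fun j => (c *m a) 0 j)
    - \sum_(u | (u != v) && (u != v0)) (c *m a) 0 u *: (xs * 'X_u).
  rewrite /linear_form (bigD1 v) //= (bigD1 v0) 1?eq_sym //= cv cv0 scale1r.
  rewrite !mulrDr mulr_sumr; under [X in _ + (_ + X)]eq_bigr do rewrite -scalerAr.
  by rewrite addrA addrK -!scalerAr scalerA scaleNr.
apply: reductionB.
  rewrite -linear_form_comb; apply: reductionMl; apply: reduction_sum => l _.
  exact/reductionZ/reduction_theta.
apply: reduction_sum => u /andP[uv uv0].
case: (boolP (u \in A)) => [Au|/out]; last exact: reductionZ.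
by rewrite cu // scale0r; apply: reduction0.
Qed.

Lemma star_mnm_mod (L : 'X_{1..m}) :
  I (xs * 'X_[L] - 'X_[L].@[lam] *: (xs * y ^+ mdeg L)).
Proof.
move: {2}(mdeg L) (erefl (mdeg L)) => k; elim: k L => [|k IH] L dL.
  have /eqP-> : L == 0%MM by rewrite -mdeg_eq0 dL.
  by rewrite mdeg0 mpolyX0 meval1 expr0 scale1r subrr; apply: reduction0.
have [|v [L' defL]] := @mdeg_neq0_factor _ L; first by rewrite dL.
have dL' : mdeg L' = k.
  by apply/eqP; rewrite -eqSS -dL defL mdegD mdeg1.
have:= reductionD (reductionMl 'X_v (IH L' dL'))
  (reductionZ 'X_[L'].@[lam] (reductionMl (y ^+ k) (star_var v))).
congr (I _); rewrite defL mpolyXD mevalM mevalXU mdegD mdeg1 dL' add1n exprS.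
rewrite -!mul_mpolyC !mpolyCM; ring.
Qed.

(** Modulo the parameters the ideal of the face [s] has dimension at most one
    in each degree, and evaluation at the dependency is a coordinate on it. *)
Lemma star_class_mod j (M : 'X_{1..m}) : mdeg M = j -> s \subset mnm_support M ->
  I ('X_[M] - 'X_[M].@[lam] *: star_class j).
Proof.
move=> dM /squarefree_le sM.
have defM : M = (squarefree_mnm s + (M - squarefree_mnm s))%MM.
  by rewrite addmC submK.
set L := (M - _)%MM in defM; have dL : (j - #|s|)%N = mdeg L.
  by rewrite -dM defM mdegD mdeg_squarefree addKn.
have nz_s : xs.@[lam] != 0.
  by rewrite mevalX_in // mnm_support_squarefree.
have -> : 'X_[M].@[lam] *: star_class j = 'X_[L].@[lam] *: (xs * y ^+ mdeg L).
  rewrite /star_class /star_mnm dL defM !mpolyXD !mevalM -!mpolyXn rmorphXn /=.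
  rewrite mevalXU scalerA exprZn exprVn -scalerAr scalerA; congr (_ *: _).
  have := lam_in Av0; set x := lam v0 => x0; field.
  by rewrite nz_s expf_neq0.
by rewrite defM mpolyXD; apply: star_mnm_mod.
Qed.

End OneSide.

Section Flip.
Variables (D D' : {set {set 'I_m}}) (s t : {set 'I_m}).
Hypotheses (defA : A = s :|: t) (flip : half_flip D D' s t)
  (flip' : half_flip D' D t s).
Local Notation I := (reduction_ideal D theta).
Local Notation I' := (reduction_ideal D' theta).

Let sA : s \subset A. Proof. by rewrite defA subsetUl. Qed.
Let linkD v : v \notin A -> v |: s \notin D.
Proof. by rewrite defA; apply: hf_link flip v. Qed.

(** In degrees below [#|s|] the ideal of the face [s] is zero. *)
Definition star_class0 j := if (#|s| <= j)%N then star_class s j else 0.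

(** The ideals of [D] and [D'] differ by at most a line in each degree: the
    generators of the second which are not in the first are the multiples of the
    monomial of [s], and [lam] is a zero of all the others. *)
Lemma flip_ideal j p : p \is j.-homog -> I' p ->
  I (p - p.@[lam] *: star_class0 j) /\ ((j < #|s|)%N -> p.@[lam] = 0).
Proof.
apply: (@reduction_homog_ind _ _ _ D' theta j (fun p =>
  I (p - p.@[lam] *: star_class0 j) /\ ((j < #|s|)%N -> p.@[lam] = 0))).
- exact: hf_closed flip'.
- by move=> l; apply: linear_form_homog.
- by rewrite meval0 scale0r subrr; split=> //; apply: reduction0.
- move=> q r [Iq zq] [Ir zr]; rewrite mevalD; split.
    by rewrite scalerDl opprD addrACA; apply: reductionD.
  by move=> js; rewrite zq // zr // addr0.
- move=> c M l _; rewrite mevalZ mevalM meval_theta !mulr0 scale0r subr0.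
  by split=> //; apply/reductionZ/reductionMl/reduction_theta.
- move=> c M dM MD'; rewrite mevalZ.
  case: (boolP (s \subset mnm_support M)) => sM.
    have sj : (#|s| <= j)%N.
      by rewrite -dM (leq_trans (subset_leq_card sM)) // card_mnm_support.
    rewrite ltnNge sj; split=> //.
    rewrite /star_class0 sj -scalerA -scalerBr; apply: reductionZ.
    exact: star_class_mod.
  have /andP[MD] := hf_outside flip MD' sM; rewrite -defA => MA.
  rewrite mevalX_out // mulr0 scale0r subr0; split=> //.
  exact/reductionZ/(reduction_nonface _ MD).
Qed.

End Flip.

Section Transfer.
Variables (D D' : {set {set 'I_m}}) (s t : {set 'I_m}).
Hypotheses (defA : A = s :|: t) (flip : half_flip D D' s t)
  (flip' : half_flip D' D t s).
Hypothesis card_st : (#|s| + #|t|)%N = d.+1.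
Hypotheses (s_gt0 : (0 < #|s|)%N) (t_gt0 : (0 < #|t|)%N).
Local Notation I := (reduction_ideal D theta).
Local Notation I' := (reduction_ideal D' theta).

Let defA' : A = t :|: s. Proof. by rewrite setUC. Qed.
Let sA : s \subset A. Proof. by rewrite defA subsetUl. Qed.
Let tA : t \subset A. Proof. by rewrite defA subsetUr. Qed.
Let linkD v : v \notin A -> v |: s \notin D.
Proof. by rewrite defA; apply: hf_link flip v. Qed.
Let sd : (#|s| <= d)%N.
Proof. by rewrite -ltnS -card_st -addn1 leq_add2l. Qed.
Let td : (#|t| <= d)%N.
Proof. by rewrite -ltnS -card_st -add1n leq_add2r. Qed.

Lemma star_class_nonface j v : t \notin D -> I (v * star_class t j).
Proof.
move=> tD; apply/reductionMl/reductionZ.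
by apply: (reduction_nonface _ tD); case: (star_mnm_support tA j).
Qed.

Lemma top_class_flip : I' (star_class t d) -> I (star_class s d).
Proof.
move=> zt; have [] := flip_ideal defA flip flip' (star_class_homog td) zt.
rewrite meval_star_class // scale1r /star_class0 sd => Ez _.
have := reductionB (star_class_nonface d 1 (hf_new flip)) Ez.
by rewrite mul1r subKr.
Qed.

(** If [u] is orthogonal to everything in the reduction of [D'] then in that of
    [D] its pairing with [v] is [u.@[lam] * v.@[lam]] times the top class of [s],
    by [flip_ideal]. When [s] has a multiple in degree [i], subtracting it from
    [u] removes this form of rank one without changing [u] in the reduction of
    [D']. Otherwise [t] has a multiple in the complementary degree; it is zero in
    the reduction of [D], so that [u.@[lam]] vanishes because the top class does
    not. Either way a class orthogonal to everything in [D] is obtained. *)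
Lemma nondegenerate_flip i : (i <= d)%N -> ~ I (star_class s d) ->
  nondegenerate_in D theta i -> nondegenerate_in D' theta i.
Proof.
move=> id nz_s nd u hu uI.
have hd v : v \is (d - i).-homog -> u * v \is d.-homog.
  by move=> hv; rewrite -(subnKC id); apply: dhomogM.
have mod_top v : v \is (d - i).-homog ->
    I (u * v - (u.@[lam] * v.@[lam]) *: star_class s d).
  move=> hv; have [] := flip_ideal defA flip flip' (hd v hv) (uI v hv).
  by rewrite /star_class0 sd mevalM.
have from_D p : p \is i.-homog -> p.@[lam] = 0 -> I p -> I' p.
  move=> hp p0 Ip; have [] := flip_ideal defA' flip' flip hp Ip.
  by rewrite p0 scale0r subr0.
case: (leqP #|s| i) => [si|si].
  pose w := u - u.@[lam] *: star_class s i.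
  have hw : w \is i.-homog by rewrite rpredB // rpredZ // star_class_homog.
  have w0 : w.@[lam] = 0 by rewrite mevalB mevalZ meval_star_class // mulr1 subrr.
  have Iw : I w.
    apply: nd => // v; move: v; apply: homog_ind.
    - by rewrite mulr0; apply: reduction0.
    - by move=> p q Ip Iq; rewrite mulrDr; apply: reductionD.
    move=> c M dM; rewrite -scalerAr; apply: reductionZ.
    have hM : 'X_[M] \is [in K[m], (d - i).-homog] by rewrite dhomogX /= dM.
    have sM : I (star_class s i * 'X_[M] - 'X_[M].@[lam] *: star_class s d).
      have := @star_class_mod D s sA linkD d (star_mnm s i + M)%MM.
      rewrite mdegD mdeg_star_mnm // dM subnKC // => /(_ erefl).
      rewrite mnm_supportD; have [sS _] := star_mnm_support sA i.
      move=> /(_ (subset_trans sS (subsetUl _ _))).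
      move/(reductionZ ('X_[star_mnm s i].@[lam])^-1).
      rewrite scalerBr scalerA mpolyXD mevalM mulKf ?scalerAl //.
      by rewrite mevalX_in //; case: (star_mnm_support sA i).
    have := reductionB (mod_top _ hM) (reductionZ u.@[lam] sM).
    congr (I _); rewrite /w mulrBl -[(_ *: star_class s i) * _]scalerAl.
    rewrite scalerBr [u.@[_] *: (_ *: _)]scalerA.
    by rewrite opprB addrA subrK.
  have Is : I' (u.@[lam] *: star_class s i).
    apply: reductionZ; rewrite -[star_class s i]mul1r.
    apply/reductionMl/reductionZ/(reduction_nonface _ (hf_new flip')).
    by case: (star_mnm_support sA i).
  by rewrite -[u](subrK (u.@[lam] *: star_class s i)); apply: reductionD => //;
     apply: from_D.
have ti : (#|t| <= d - i)%N.
  by rewrite leq_subRL // -ltnS -addSn -card_st leq_add2r.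
have u0 : u.@[lam] = 0.
  apply/eqP/negP => /negP nz; apply: nz_s.
  have := reductionB (star_class_nonface (d - i) u (hf_new flip))
    (mod_top _ (star_class_homog ti)).
  rewrite meval_star_class // mulr1 subKr.
  by move/(reductionZ (u.@[lam])^-1); rewrite scalerA mulVf // scale1r.
apply: from_D => //; apply: nd => // v hv.
by have := mod_top v hv; rewrite u0 mul0r scale0r subr0.
Qed.

End Transfer.
End Dependency.

(** * Maximal minors in characteristic 2 *)

Lemma sum_involution2 (K : fieldType) (charK : (2 \in [pchar K])%R) (J : finType)
    (P : pred J) (f : J -> J) (F : J -> K) :
  (forall x, P x -> [/\ P (f x), f (f x) = x, f x != x & F (f x) = F x]) ->
  \sum_(x | P x) F x = 0.
Proof.
move=> fP; rewrite (bigID (fun x => (enum_rank x < enum_rank (f x))%N)) /=.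
rewrite [X in _ + X](reindex_onto f f) /=; last by move=> x /andP[/fP[]].
rewrite [X in _ + X](eq_big (fun x => P x && (enum_rank x < enum_rank (f x))%N) F).
- exact: addrr_pchar2.
- move=> x; apply/andP/andP => [[/andP[Pfx lt] /eqP fx]|[Px lt]].
    have [] := fP _ Pfx; rewrite fx => Px _ xfx _; split=> //.
    rewrite fx -leqNgt in lt; rewrite ltn_neqAle lt andbT.
    by apply: contraNneq xfx => /val_inj/enum_rank_inj/eqP.
  by have [-> -> _ _] := fP x Px; rewrite eqxx -leqNgt ltnW.
- move=> x /andP[/andP[Pfx _] /eqP fx].
  by have [] := fP _ Pfx; rewrite fx.
Qed.

Section SetDeterminant.
Variables (K : fieldType) (m d : nat) (a : 'M[K]_(d, m)).
Implicit Types (s F : {set 'I_m}) (g : {ffun 'I_d -> 'I_m}).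

(** The maximal minor with columns [s]. Without signs the order of the columns is
    irrelevant, and the determinant is the sum over their enumerations. *)
Definition set_det s : K :=
  \sum_(g : {ffun 'I_d -> 'I_m} | [set g i | i : 'I_d] == s) \prod_i a i (g i).

Definition general_position : Prop :=
  forall s, #|s| = d -> set_det s != 0.

Lemma enumeration_inj g s : #|s| = d -> [set g i | i : 'I_d] = s -> injective g.
Proof.
move=> cs gs; apply: in2T; apply/imset_injP.
by apply/eqP; rewrite gs cs card_ord.
Qed.

Lemma enumeration_exists s : #|s| = d ->
  exists g, injective g /\ [set g i | i : 'I_d] = s.
Proof.
move=> cs; exists [ffun i => enum_val (cast_ord (esym cs) i)]; split.
  by move=> i j; rewrite !ffunE => /enum_val_inj/cast_ord_inj.
apply/setP=> v; apply/imsetP/idP => [[i _ ->]|vs]; first by rewrite ffunE enum_valP.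
exists (cast_ord cs (enum_rank_in vs v)) => //.
by rewrite ffunE cast_ordK enum_rankK_in.
Qed.

Section Char2.
Hypothesis charK : (2 \in [pchar K])%R.

Lemma set_det_det g : injective g ->
  set_det [set g i | i : 'I_d] = \det (colsub g a).
Proof.
move=> ginj; rewrite /determinant /set_det.
pose f (p : 'S_d) : {ffun 'I_d -> 'I_m} := [ffun i => g (p i)].
have finj : injective f.
  move=> p p' E; apply/permP=> i; apply: ginj.
  by move/ffunP: E => /(_ i); rewrite !ffunE.
rewrite (eq_bigl (mem [set f p | p in setT])) => [|h]; last first.
  apply/eqP/imsetP => [him|[p _ ->]]; last first.
    apply/setP=> v; apply/imsetP/imsetP => -[i _ ->].
      by exists (p i); rewrite ?ffunE.
    by exists ((p^-1)%g i); rewrite ?ffunE ?permKV.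
  have hinj : injective h.
    by apply: (enumeration_inj _ him); rewrite card_imset // card_ord.
  have /fin_all_exists[k kP] : forall i, exists j, g j = h i.
    move=> i.
    have : h i \in [set g i | i : 'I_d] by rewrite -him imset_f.
    by case/imsetP=> j _ ->; exists j.
  have kinj : injective k by move=> i j E; apply: hinj; rewrite -!kP E.
  by exists (perm kinj); rewrite ?inE //; apply/ffunP=> i; rewrite ffunE permE kP.
rewrite big_imset /=; last by move=> p q _ _ /finj.
apply: eq_big => [p|p _]; first by rewrite inE.
have -> : (-1) ^+ p = 1 :> K by rewrite (oppr_pchar2 charK) expr1n.
by rewrite mul1r; apply: eq_bigr => i _; rewrite ffunE mxE.
Qed.

(** Cramer's rule: the maximal minors of [d.+1] columns are the coefficients of
    a linear dependency between them; in characteristic 2 there are no signs,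
    and the terms of the sum cancel in pairs. *)
Lemma set_det_dependency s l : #|s| = d.+1 ->
  \sum_(j in s) a l j * set_det (s :\ j) = 0.
Proof.
move=> cs.
under eq_bigr do rewrite /set_det mulr_sumr.
rewrite pair_big_dep /=.
pose f (x : 'I_m * {ffun 'I_d -> 'I_m}) :=
  (x.2 l, [ffun i => if i == l then x.1 else x.2 i] : {ffun 'I_d -> 'I_m}).
apply: (sum_involution2 charK (f := f)) => -[j g] /= /andP[js /eqP gs].
have ginj : injective g.
  by apply: enumeration_inj gs; have := cardsD1 j s; rewrite js cs => -[].
have gls : g l \in s :\ j by rewrite -gs imset_f.
have /andP[glj gl_s] : (g l != j) && (g l \in s) by move: gls; rewrite !inE.
rewrite /f /= !ffunE eqxx; split.
- rewrite gl_s /=; apply/eqP/setP=> v; rewrite !inE.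
  apply/imsetP/andP => [[i _ ->]|[vgl vs]].
    rewrite ffunE; case: (eqVneq i l) => [_|il]; first by rewrite eq_sym.
    have : g i \in s :\ j by rewrite -gs imset_f.
    by rewrite !inE => /andP[_ ->]; rewrite (inj_eq ginj).
  case: (eqVneq v j) => [->|vj]; first by exists l; rewrite ?ffunE ?eqxx.
  have : v \in [set g i | i : 'I_d] by rewrite gs !inE vj.
  case/imsetP=> i _ E; exists i => //; rewrite ffunE ifN //.
  by apply: contraNneq vgl => <-; rewrite E.
- congr (_, _); apply/ffunP=> i; rewrite !ffunE.
  by case: eqP => // ->.
- by apply: contra glj => /eqP[->].
- rewrite (bigD1 l) //= [in RHS](bigD1 l) //= ffunE eqxx mulrCA; congr (_ * (_ * _)).
  by apply: eq_bigr => i /negPf il; rewrite ffunE il.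
Qed.

Lemma dual_vector s v : general_position -> #|s| = d -> v \in s ->
  exists c : 'rV_d, (c *m a) 0 v = 1 /\
    forall u, u \in s -> u != v -> (c *m a) 0 u = 0.
Proof.
move=> gp cs vs; have [g [ginj gs]] := enumeration_exists cs.
have uB : colsub g a \in unitmx.
  by rewrite unitmxE unitfE -set_det_det // gp // gs.
have : v \in [set g i | i : 'I_d] by rewrite gs.
case/imsetP=> i0 _ vi0; exists (row i0 (invmx (colsub g a))).
have E k : (row i0 (invmx (colsub g a)) *m a) 0 (g k) = (i0 == k)%:R.
  have := mulVmx uB => /matrixP/(_ i0 k); rewrite !mxE => <-.
  by apply: eq_bigr => j _; rewrite !mxE.
split; first by rewrite vi0 E eqxx.
move=> u; rewrite -gs => /imsetP[k _ ->]; rewrite vi0 (inj_eq ginj) E eq_sym.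
by move/negPf->.
Qed.

Lemma superset_of_card s : (#|s| <= d <= m)%N ->
  exists2 F : {set 'I_m}, s \subset F & #|F| = d.
Proof.
case/andP=> sd; rewrite -{1}[m]card_ord -cardsT.
elim: d sd => [|k IH] sk km.
  by exists s => //; apply/eqP; rewrite -leqn0.
move: sk; rewrite leq_eqVlt => /orP[/eqP<-|]; first by exists s.
rewrite ltnS => /IH/(_ (ltnW km))[F sF cF].
have : F \proper setT by rewrite properEcard subsetT cF.
case/properP=> _ [v _ vF]; exists (v |: F); last by rewrite cardsU1 vF cF.
exact: subset_trans sF (subsetUr _ _).
Qed.

Definition dependency s (j : 'I_m) : K := if j \in s then set_det (s :\ j) else 0.

Lemma dependency_sum s l : #|s| = d.+1 -> \sum_j a l j * dependency s j = 0.
Proof.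
move=> cs; rewrite -[RHS](set_det_dependency l cs) [RHS]big_mkcond.
by apply: eq_bigr => j _; rewrite /dependency; case: ifP => //; rewrite mulr0.
Qed.

Lemma dependency_neq0 s j : general_position -> #|s| = d.+1 -> j \in s ->
  dependency s j != 0.
Proof.
move=> gp cs js; rewrite /dependency js; apply: gp.
by have := cardsD1 j s; rewrite js cs => -[].
Qed.

End Char2.
End SetDeterminant.

(** * The fundamental class *)

Section FundamentalClass.
Variables (K : fieldType) (charK : (2 \in [pchar K])%R).
Variables (m d : nat) (a : 'M[K]_(d, m)) (gp : general_position a).
Variables (D : {set {set 'I_m}}) (o : 'I_m).
Hypothesis Dclosed : down_closed D.
Hypothesis oD : forall s : {set 'I_m}, s \in D -> o \notin s.
Hypothesis d_lt : (d < m)%N.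
Hypothesis ridges : forall G : {set 'I_m}, #|G|.+1 = d ->
  ~~ odd #|[set F in D | (#|F| == d) && (G \subset F)]|.
Local Notation theta := (matrix_forms a).
Local Notation I := (reduction_ideal D theta).
Let facets := [set F in D | #|F| == d].

(** The dependency between the columns of the simplex [o |: F], with its
    coordinate at the apex [o] replaced by zero: the apex is not a vertex of [D],
    and the monomials divisible by its variable have to evaluate to zero. *)
Definition cone_point (F : {set 'I_m}) (j : 'I_m) : K :=
  if j \in F then set_det a (o |: F :\ j) else 0.

Lemma facetP F : F \in facets -> [/\ F \in D, #|F| = d & o \notin F].
Proof. by rewrite inE => /andP[FD /eqP cF]; split=> //; apply: oD. Qed.

Lemma cone_point_neq0 F j : F \in facets -> j \in F -> cone_point F j != 0.
Proof.
move=> /facetP[_ cF oF] jF; rewrite /cone_point jF; apply: gp.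
have jo : o \notin F :\ j by rewrite !inE negb_and oF orbT.
by have := cardsD1 j F; rewrite jF cF cardsU1 jo => ->.
Qed.

Lemma cone_point_theta F l : F \in facets ->
  \sum_j a l j * cone_point F j = a l o * set_det a F.
Proof.
move=> /facetP[_ cF oF].
have := @dependency_sum _ _ _ a charK (o |: F) l; rewrite cardsU1 oF cF.
move=> /(_ erefl); rewrite (bigD1 o) //= [in LHS]addrC => /eqP.
rewrite addr_eq0 oppr_pchar2 // => /eqP E.
rewrite (bigD1 o) //= {1}/cone_point (negPf oF) mulr0 add0r.
transitivity (\sum_(i | i != o) a l i * dependency a (o |: F) i).
  apply: eq_bigr => j jo; rewrite /dependency /cone_point !inE (negPf jo) /=.
  case: ifP => // jF; congr (_ * set_det a _); apply/setP=> v; rewrite !inE.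
  by case: (eqVneq v j) => // ->; rewrite (negPf jo).
rewrite E /dependency setU11; congr (_ * set_det a _).
by rewrite setU1K.
Qed.

Lemma cone_point_out (F : {set 'I_m}) (M : 'X_{1..m}) : ~~ (mnm_support M \subset F) ->
  'X_[M].@[cone_point F] = 0.
Proof. by apply: mevalX_out => v vF; rewrite /cone_point (negPf vF). Qed.

(** Since every parameter takes at [cone_point F] a value proportional to
    [set_det a F], the value of [fundamental_form] at a multiple of a parameter is
    a multiple of [ridge_sum]. *)
Definition ridge_sum (q : {mpoly K[m]}) : K :=
  \sum_(F in facets) (\prod_(j in F) cone_point F j)^-1 * q.@[cone_point F].

(** Lee's formula for the degree map: the sum over the facets [F] of the degree
    maps of the boundaries of the simplices [o |: F]. *)
Definition fundamental_form (q : {mpoly K[m]}) : K :=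
  \sum_(F in facets) (set_det a F * \prod_(j in F) cone_point F j)^-1
    * q.@[cone_point F].

Lemma meval_squarefree (x : 'I_m -> K) (s : {set 'I_m}) :
  'X_[squarefree_mnm s].@[x] = \prod_(j in s) x j.
Proof.
rewrite mevalX [RHS]big_mkcond; apply: eq_bigr => j _; rewrite mnmE.
by case: (j \in s).
Qed.

Lemma ridge_sum0 : ridge_sum 0 = 0.
Proof. by rewrite /ridge_sum big1 // => F _; rewrite meval0 mulr0. Qed.

Lemma ridge_sum_linear c p q : ridge_sum (c *: p + q) = c * ridge_sum p + ridge_sum q.
Proof.
rewrite /ridge_sum mulr_sumr -big_split; apply: eq_bigr => F _ /=.
by rewrite mevalD mevalZ mulrDr mulrCA.
Qed.

(** For a squarefree monomial, whose support is a ridge [G], every facet through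
    [G] contributes the inverse of the same minor, of the columns [o |: G], and
    the number of these facets is even. A monomial with a multiple variable [v]
    reduces to monomials of larger support by a combination of the parameters
    which is zero at the apex and at the support except [v]: having no term at
    the apex, it vanishes at all points [cone_point F]. *)
Lemma ridge_sumX (M : 'X_{1..m}) : (mdeg M).+1 = d -> ridge_sum 'X_[M] = 0.
Proof.
move: {2}(mdeg M - #|mnm_support M|)%N (erefl (mdeg M - #|mnm_support M|)%N) => k.
elim: k M => [|k IH] M dk dM; set s := mnm_support M in dk.
  have defM : M = squarefree_mnm s.
    have /squarefree_le sM : s \subset mnm_support M by [].
    have := submK sM => E; have dE : mdeg (M - squarefree_mnm s)%MM = 0%N.
      have := congr1 mdeg E; rewrite mdegD mdeg_squarefree => dE.
      apply/eqP; rewrite -(eqn_add2r #|s|) dE add0n eqn_leq.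
      by rewrite -subn_eq0 dk eqxx card_mnm_support.
    by rewrite -{1}E; move/eqP: dE; rewrite mdeg_eq0 => /eqP->; rewrite add0m.
  have cs : #|s|.+1 = d by rewrite -dM defM mdeg_squarefree.
  rewrite /ridge_sum (bigID (fun F : {set 'I_m} => s \subset F)) /=.
  rewrite [X in _ + X]big1 ?addr0 => [|F /andP[_ sF]]; last first.
    by rewrite cone_point_out ?mulr0.
  rewrite (eq_bigr (fun=> (set_det a (o |: s))^-1)) => [|F /andP[fF sF]].
    rewrite sumr_const -mulr_natr.
    set N := #|_|; have : ~~ odd N.
      have := ridges cs; congr (~~ odd _); apply: eq_card => F.
      by rewrite [RHS]unfold_in /= !inE andbA.
    move=> /negPf oN; rewrite -(odd_double_half N) oN.
    by rewrite add0n -muln2 natrM (pcharf0 charK) !mulr0.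
  have [_ cF oF] := facetP fF.
  have /cards1P[v Fs] : #|F :\: s| == 1%N.
    by rewrite cardsDS // cF -cs subSnn.
  have vF : v \in F by have := set11 v; rewrite -Fs inE => /andP[].
  have defs : F :\ v = s by rewrite -Fs setDDr setDv set0U; apply/setIidPr.
  rewrite defM meval_squarefree (bigD1 v) //= {1}/cone_point vF defs.
  have -> : \prod_(i in F | i != v) cone_point F i = \prod_(i in s) cone_point F i.
    by apply: eq_bigl => i; rewrite -defs !inE andbC.
  rewrite invfM mulfVK //; apply/prodf_neq0 => i i_s.
  by apply: cone_point_neq0 => //; apply: (subsetP sF).
have lt_s : (#|s| < mdeg M)%N by rewrite -subn_gt0 dk.
have [v Mv] : exists v, (1 < M v)%N.
  apply/existsP; apply: contraTT lt_s; rewrite negb_exists -leqNgt => /forallP z.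
  rewrite mdegE -sum1_card [leqRHS]big_mkcond; apply: leq_sum => j _.
  by have := z j; rewrite -leqNgt inE; case: (M j) => // -[].
have UM : (U_(v) <= M)%MM by rewrite lep1mP -lt0n ltnW.
pose M' := (M - U_(v))%MM; have defM : M = (U_(v) + M')%MM by rewrite addmC submK.
have vs : v \in s by rewrite inE -lt0n ltnW.
have sM' : mnm_support M' = s.
  apply/setP=> j; rewrite !inE mnmBE mnm1E; case: (eqVneq v j) => [<-|_].
    by move: Mv; case: (M v) => [|[]].
  by rewrite subn0.
have dM' : (mdeg M').+1 = mdeg M by rewrite defM mdegD mdeg1.
case: (boolP (o \in s)) => os.
  rewrite /ridge_sum big1 // => F /facetP[_ _ oF].
  rewrite cone_point_out ?mulr0 //; apply: contra oF => /subsetP; exact.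
have cs' : (#|o |: s| <= d <= m)%N.
  by rewrite (ltnW d_lt) andbT cardsU1 os -dM ltnS ltnW.
have [A sA cA] := superset_of_card cs'.
have vA : v \in A by rewrite (subsetP sA) // inE vs orbT.
have [c [cv cu]] := dual_vector charK gp cA vA.
have kill q : ridge_sum (linear_form (fun j => (c *m a) 0 j) * q) = 0.
  rewrite /ridge_sum big1 // => F fF; rewrite mevalM meval_linear_form.
  have -> : \sum_j (c *m a) 0 j * cone_point F j = 0.
    under eq_bigr do rewrite mxE mulr_suml.
    rewrite exchange_big /=; transitivity ((c *m a) 0 o * set_det a F).
      rewrite mxE mulr_suml; apply: eq_bigr => l _.
      rewrite -mulrA -cone_point_theta // mulr_sumr.
      by apply: eq_bigr => j _; rewrite mulrA.
    rewrite cu ?mul0r // ?(subsetP sA) ?setU11 //.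
    by apply: contraNneq os => ->.
  by rewrite mul0r mulr0.
have := kill 'X_[M']; rewrite /linear_form mulr_suml (bigD1 v) //= cv scale1r.
rewrite -mpolyXD -defM => /eqP; rewrite -[X in X + _]scale1r ridge_sum_linear mul1r.
rewrite addr_eq0 => /eqP->; apply/eqP; rewrite oppr_eq0; apply/eqP.
elim/big_ind: _ => [|p q zp zq|j jv].
- exact: ridge_sum0.
- by rewrite -[p]scale1r ridge_sum_linear zp zq mulr0 addr0.
case: (boolP (j \in s)) => js.
  rewrite cu ?scale0r ?mul0r //; last by rewrite (subsetP sA) // inE js orbT.
  exact: ridge_sum0.
rewrite -scalerAl -mpolyXD -[X in ridge_sum X]addr0 ridge_sum_linear IH; first last.
- by rewrite mdegD mdeg1 add1n dM'.
- rewrite mdegD mdeg1 add1n dM' mnm_supportD mnm_supportU sM' cardsU1 js.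
  by rewrite subnS dk.
by rewrite mulr0 add0r ridge_sum0.
Qed.

Lemma fundamental_form_ideal p : I p -> fundamental_form (pihomog mdeg d p) = 0.
Proof.
apply: (@reduction_graded_ind _ _ _ D theta d (fun q => fundamental_form q = 0)) => //.
- by move=> l; apply: linear_form_homog.
- by rewrite /fundamental_form big1 // => F _; rewrite meval0 mulr0.
- move=> q r zq zr; transitivity (fundamental_form q + fundamental_form r).
    rewrite /fundamental_form -big_split; apply: eq_bigr => F _ /=.
    by rewrite mevalD mulrDr.
  by rewrite zq zr addr0.
- move=> c M l dM; transitivity (c * a l o * ridge_sum 'X_[M]); last first.
    by rewrite ridge_sumX // mulr0.
  rewrite /fundamental_form /ridge_sum [RHS]mulr_sumr; apply: eq_bigr => F fF.
  rewrite mevalZ mevalM meval_linear_form cone_point_theta //.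
  have [_ cF _] := facetP fF; have := gp cF; set x := set_det a F => x0.
  have : \prod_(j in F) cone_point F j != 0.
    by apply/prodf_neq0 => j; apply: cone_point_neq0.
  set y := \prod_(j in F) _ => y0; field.
  by rewrite x0 y0.
move=> c M dM MD; rewrite /fundamental_form big1 // => F /facetP[FD _ _].
by rewrite mevalZ cone_point_out ?mulr0 //; apply: contra MD; apply: Dclosed.
Qed.

Lemma facet_notin_reduction F : F \in D -> #|F| = d -> ~ I 'X_[squarefree_mnm F].
Proof.
move=> FD cF /fundamental_form_ideal.
rewrite pihomog_dE; last by rewrite dhomogX /= mdeg_squarefree cF.
have fF : F \in facets by rewrite inE FD cF eqxx.
rewrite /fundamental_form (bigD1 F) //= [X in _ + X]big1 ?addr0
  => [|G /andP[/facetP[_ cG _] GF]].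
  rewrite meval_squarefree invfM mulfVK.
    by move/eqP; rewrite invr_eq0; apply/negP/gp.
  by apply/prodf_neq0 => j; apply: cone_point_neq0.
rewrite cone_point_out ?mulr0 // mnm_support_squarefree.
by apply: contra GF => sFG; rewrite eq_sym eqEcard sFG cG cF leqnn.
Qed.

End FundamentalClass.

(** * Linear algebra in a fixed degree *)

Section Coordinates.
Variables (m : nat).

Definition mnm_of_deg j := {M : 'X_{1..m < j.+1} | mdeg M == j}.

Definition nmnm j := #|{: mnm_of_deg j}|.

Definition nth_mnm j (x : 'I_(nmnm j)) : 'X_{1..m} := val (val (enum_val x)).

Lemma mdeg_nth_mnm j (x : 'I_(nmnm j)) : mdeg (nth_mnm x) = j.
Proof. exact/eqP/(valP (enum_val x)). Qed.

Lemma nth_mnm_inj j : injective (@nth_mnm j).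
Proof. by move=> x y /val_inj/val_inj/enum_val_inj. Qed.

Lemma nth_mnm_surj j (M : 'X_{1..m}) : mdeg M = j -> exists x, M = nth_mnm (j := j) x.
Proof.
move=> dM; have ltM : (mdeg M < j.+1)%N by rewrite dM.
have eqM : mdeg (BMultinom ltM) == j by apply/eqP.
exists (enum_rank (Sub (BMultinom ltM) eqM : mnm_of_deg j)).
by rewrite /nth_mnm enum_rankK.
Qed.

Variable K : fieldType.

Definition mpoly_row j (p : {mpoly K[m]}) : 'rV[K]_(nmnm j) :=
  \row_x p@_(nth_mnm x).

Lemma mpoly_row_linear j c p q :
  mpoly_row j (c *: p + q) = c *: mpoly_row j p + mpoly_row j q.
Proof. by apply/rowP=> x; rewrite !mxE mcoeffD mcoeffZ. Qed.

Lemma mpoly_row0 j : mpoly_row j 0 = 0.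
Proof. by apply/rowP=> x; rewrite !mxE mcoeff0. Qed.

Lemma mpoly_rowD j p q : mpoly_row j (p + q) = mpoly_row j p + mpoly_row j q.
Proof. by apply/rowP=> x; rewrite !mxE mcoeffD. Qed.

Lemma mpoly_rowZ j c p : mpoly_row j (c *: p) = c *: mpoly_row j p.
Proof. by apply/rowP=> x; rewrite !mxE mcoeffZ. Qed.

Lemma mpoly_row_sum j (J : finType) (F : J -> {mpoly K[m]}) :
  mpoly_row j (\sum_x F x) = \sum_x mpoly_row j (F x).
Proof.
by apply: (big_morph (mpoly_row j)); [apply: mpoly_rowD|apply: mpoly_row0].
Qed.

Lemma mpoly_row_inj j p q : p \is j.-homog -> q \is j.-homog ->
  mpoly_row j p = mpoly_row j q -> p = q.
Proof.
move=> hp hq /rowP E; apply/mpolyP=> M.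
case: (eqVneq (mdeg M) j) => [/nth_mnm_surj[x ->]|dM].
  by have := E x; rewrite !mxE.
by rewrite (dhomog_nemf_coeff hp dM) (dhomog_nemf_coeff hq dM).
Qed.

Lemma homog_sum_nth j p : p \is j.-homog ->
  p = \sum_x mpoly_row j p 0 x *: 'X_[nth_mnm x].
Proof.
move=> hp; apply: (@mpoly_row_inj j) => //.
  by apply: rpred_sum => x _; rewrite rpredZ // dhomogX /= mdeg_nth_mnm.
apply/rowP=> y; rewrite !mxE raddf_sum /= (bigD1 y) //= mcoeffZ mcoeffX eqxx mulr1.
rewrite big1 ?addr0 ?mxE // => x xy; rewrite mcoeffZ mcoeffX.
by rewrite (inj_eq (@nth_mnm_inj j)) (negPf xy) mulr0.
Qed.

Lemma mcoeff_pihomog j (p : {mpoly K[m]}) M : mdeg M = j ->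
  (pihomog mdeg j p)@_M = p@_M.
Proof.
move=> dM; elim/mpolyind: p => [|c L p _ _ IH]; first by rewrite pihomog0.
rewrite pihomogD linearZ /= !mcoeffD !mcoeffZ IH pihomogX /=; congr (_ * _ + _).
case: eqP => // dL; rewrite mcoeff0 mcoeffX; case: eqP => // LM.
by case: dL; rewrite LM.
Qed.

Lemma mpoly_row_pihomog j p : mpoly_row j (pihomog mdeg j p) = mpoly_row j p.
Proof. by apply/rowP=> x; rewrite !mxE mcoeff_pihomog // mdeg_nth_mnm. Qed.

Variables (d : nat) (D : {set {set 'I_m}}) (a : 'M[K]_(d, m)).
Local Notation theta := (matrix_forms a).
Local Notation I := (reduction_ideal D theta).

Definition generator_index j := ('I_(nmnm j.-1) * 'I_d + 'I_(nmnm j))%type.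

Definition ideal_generator j (x : generator_index j) :
    {mpoly K[m]} :=
  match x with
  | inl (y, l) => 'X_[nth_mnm y] * theta l
  | inr y => if mnm_support (nth_mnm y) \in D then 0 else 'X_[nth_mnm y]
  end.

(** Row space: the part of degree [j] of the ideal. *)
Definition ideal_mx j :=
  \matrix_(x < #|{: generator_index j}|)
    mpoly_row j (ideal_generator (enum_val x : generator_index j)).

Lemma ideal_mxP j (p : {mpoly K[m]}) : (0 < j)%N -> down_closed D ->
  p \is j.-homog -> I p <-> (mpoly_row j p <= ideal_mx j)%MS.
Proof.
move=> j0 Dc hp; split=> [Ip|].
  have gen (x : generator_index j) c q : q = ideal_generator x ->
      (mpoly_row j (c *: q) <= ideal_mx j)%MS.
    move=> ->; rewrite mpoly_rowZ scalemx_sub // -[x]enum_rankK.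
    rewrite -[X in (X <= _)%MS]
      (rowK (fun x => mpoly_row j (ideal_generator (enum_val x)))).
    exact: row_sub.
  rewrite -mpoly_row_pihomog; move: p Ip {hp}.
  apply: (@reduction_graded_ind _ _ _ D theta j
    (fun q => (mpoly_row j q <= ideal_mx j)%MS)) => //.
  - by move=> l; apply: linear_form_homog.
  - by rewrite mpoly_row0 sub0mx.
  - by move=> q r sq sr; rewrite mpoly_rowD addmx_sub.
  - move=> c M l dM; have [|y ->] := @nth_mnm_surj j.-1 M; first by rewrite -dM.
    exact: (gen (inl (y, l))).
  - move=> c M /nth_mnm_surj[y ->] yD; apply: (gen (inr y)).
    by rewrite /= (negPf yD).
case/submxP=> u E.
have -> : p = \sum_x u 0 x *: ideal_generator (enum_val x).
  apply: (mpoly_row_inj hp).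
    apply: rpred_sum => x _; apply: rpredZ.
    case: (enum_val x) => [[y l]|y] /=.
      have hy : 'X_[nth_mnm y] \is [in K[m], (j.-1).-homog].
        by rewrite dhomogX /= mdeg_nth_mnm.
      by have := dhomogM hy (linear_form_homog (a l)); rewrite addn1 prednK.
    by case: ifP => _; rewrite ?rpred0 // dhomogX /= mdeg_nth_mnm.
  rewrite E mpoly_row_sum mulmx_sum_row; apply: eq_bigr => x _.
  by rewrite mpoly_rowZ rowK.
apply: reduction_sum => x _; apply: reductionZ.
case: (enum_val x) => [[y l]|y] /=; first exact/reductionMl/reduction_theta.
case: ifPn => [_|yD]; first exact: reduction0.
exact: reduction_nonface yD (subxx _).
Qed.

Lemma ideal_mx_pihomog j p : (0 < j)%N -> down_closed D -> I p ->
  (mpoly_row j p <= ideal_mx j)%MS.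
Proof.
move=> j0 Dc Ip; rewrite -mpoly_row_pihomog.
apply/ideal_mxP => //; first exact: pihomogP.
apply: (@reduction_graded_ind _ _ _ D theta j I) => //.
- by move=> l; apply: linear_form_homog.
- exact: reduction0.
- exact: reductionD.
- by move=> *; apply/reductionZ/reductionMl/reduction_theta.
- by move=> c M _ MD; apply/reductionZ/(reduction_nonface _ MD).
Qed.

(** A homogeneous polynomial outside the ideal is detected by a coordinate of the
    cokernel of [ideal_mx]. *)
Lemma reduction_separation j p : (0 < j)%N -> down_closed D -> p \is j.-homog ->
  (forall psi : {mpoly K[m]} -> K,
     (forall c q r, psi (c *: q + r) = c * psi q + psi r) ->
     (forall q, I q -> psi q = 0) -> psi p = 0) -> I p.
Proof.
move=> j0 Dc hp psi0; apply/(ideal_mxP j0 Dc hp); rewrite submxE.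
apply/eqP/rowP=> y; rewrite [RHS]mxE.
apply: (psi0 (fun q => (mpoly_row j q *m cokermx (ideal_mx j)) 0 y)).
  by move=> c q r; rewrite mpoly_row_linear mulmxDl -scalemxAl !mxE.
move=> q Iq; have := ideal_mx_pihomog j0 Dc Iq.
by rewrite submxE => /eqP->; rewrite mxE.
Qed.

(** The row of a monomial holds its products with the monomials of the
    complementary degree, modulo the ideal; the kernel therefore consists of the
    classes orthogonal to everything. *)
Definition pairing_mx i : 'M[K]_(nmnm i, nmnm (d - i) * nmnm d) :=
  \matrix_x mxvec ((\matrix_y mpoly_row d ('X_[nth_mnm x] * 'X_[nth_mnm y]))
     *m cokermx (ideal_mx d)).

Lemma pairing_mxP i u : (0 < d)%N -> (i <= d)%N -> down_closed D ->
  u \is i.-homog -> mpoly_row i u *m pairing_mx i = 0 <->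
  (forall v, v \is (d - i).-homog -> I (u * v)).
Proof.
move=> d0 id Dc hu.
have huM v : v \is (d - i).-homog -> u * v \is d.-homog.
  by move=> hv; rewrite -(subnKC id); apply: dhomogM.
have -> : mpoly_row i u *m pairing_mx i = mxvec
    ((\matrix_y mpoly_row d (u * 'X_[nth_mnm (j := d - i) y])) *m cokermx (ideal_mx d)).
  rewrite mulmx_sum_row; under eq_bigr do rewrite rowK -linearZ /= scalemxAl.
  rewrite -linear_sum -mulmx_suml; congr (mxvec (_ *m _)).
  apply/row_matrixP => y; rewrite linear_sum /= rowK.
  under eq_bigr do rewrite linearZ /= rowK -mpoly_rowZ scalerAl.
  by rewrite -mpoly_row_sum -mulr_suml -homog_sum_nth.
split=> [/eqP|uI].
  rewrite mxvec_eq0 => /eqP E; apply: homog_ind.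
  - by rewrite mulr0; apply: reduction0.
  - by move=> p q Ip Iq; rewrite mulrDr; apply: reductionD.
  move=> c M dM; rewrite -scalerAr; apply: reductionZ.
  have hM : 'X_[M] \is [in K[m], (d - i).-homog] by rewrite dhomogX /= dM.
  apply/(ideal_mxP d0 Dc (huM _ hM)); rewrite submxE.
  have [y ->] := nth_mnm_surj dM.
  have := congr1 (row y) E; rewrite row_mul rowK => ->.
  by apply/eqP/rowP=> x; rewrite !mxE.
apply/eqP; rewrite mxvec_eq0; apply/eqP/row_matrixP => y.
rewrite row_mul rowK; have hy : 'X_[nth_mnm y] \is [in K[m], (d - i).-homog].
  by rewrite dhomogX /= mdeg_nth_mnm.
have /(ideal_mxP d0 Dc (huM _ hy)) := uI _ hy.
by rewrite submxE => /eqP->; apply/rowP=> x; rewrite !mxE.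
Qed.

Lemma nondegenerate_mxP i : (0 < i <= d)%N -> down_closed D ->
  nondegenerate_in D theta i <-> (kermx (pairing_mx i) <= ideal_mx i)%MS.
Proof.
case/andP=> i0 id Dc; have d0 : (0 < d)%N by apply: leq_trans id.
split=> [nd|le u hu /(pairing_mxP d0 id Dc hu) uP].
  apply/row_subP=> x; set r := row x _.
  pose u : {mpoly K[m]} := \sum_y r 0 y *: 'X_[nth_mnm y].
  have hu : u \is i.-homog.
    by apply: rpred_sum => y _; rewrite rpredZ // dhomogX /= mdeg_nth_mnm.
  have ru : mpoly_row i u = r.
    apply/rowP=> y; rewrite mxE raddf_sum /= (bigD1 y) //= mcoeffZ mcoeffX eqxx mulr1.
    rewrite big1 ?addr0 // => z zy; rewrite mcoeffZ mcoeffX.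
    by rewrite (inj_eq (@nth_mnm_inj i)) (negPf zy) mulr0.
  rewrite -ru; apply/(ideal_mxP i0 Dc hu); apply: nd => //.
  apply/(pairing_mxP d0 id Dc hu); rewrite ru -row_mul mulmx_ker.
  by apply/rowP=> y; rewrite !mxE.
apply/(ideal_mxP i0 Dc hu); apply: submx_trans le; exact/sub_kermxP.
Qed.

End Coordinates.

Section FieldExtension.
Variables (k K : fieldType) (f : {rmorphism k -> K}) (m d : nat).
Variables (D : {set {set 'I_m}}) (Dc : down_closed D) (a : 'M[k]_(d, m)).
Local Notation theta := (matrix_forms a).
Local Notation thetaK := (matrix_forms (map_mx f a)).

Lemma map_matrix_forms l : map_mpoly f (theta l) = thetaK l.
Proof.
rewrite raddf_sum; apply: eq_bigr => j _ /=.
by rewrite map_mpolyZ map_mpolyX mxE.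
Qed.

Lemma map_mpoly_row j (p : {mpoly k[m]}) :
  mpoly_row j (map_mpoly f p) = map_mx f (mpoly_row j p).
Proof. by apply/rowP=> x; rewrite !mxE mcoeff_map_mpoly. Qed.

Lemma map_ideal_mx j : ideal_mx D (map_mx f a) j = map_mx f (ideal_mx D a j).
Proof.
apply/row_matrixP=> x; rewrite -map_row !rowK -map_mpoly_row; congr mpoly_row.
case: (enum_val x) => [[y l]|y] /=.
  by rewrite rmorphM /= map_mpolyX map_matrix_forms.
by case: ifP => _; rewrite ?raddf0 ?map_mpolyX.
Qed.

Lemma map_pairing_mx i : pairing_mx D (map_mx f a) i = map_mx f (pairing_mx D a i).
Proof.
apply/row_matrixP=> x; rewrite -map_row !rowK map_mxvec map_mxM map_cokermx.
rewrite map_ideal_mx; congr (mxvec (_ *m _)).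
apply/row_matrixP=> y; rewrite -map_row !rowK -map_mpoly_row rmorphM /=.
by rewrite !map_mpolyX.
Qed.

(** Nondegeneracy and membership in the ideal are inclusions of row spaces, which
    do not change under field extensions. *)
Lemma nondegenerate_field_extension i : (0 < i <= d)%N ->
  nondegenerate_in D theta i <-> nondegenerate_in D thetaK i.
Proof.
move=> id; rewrite !nondegenerate_mxP // map_ideal_mx map_pairing_mx.
by rewrite -map_kermx map_submx.
Qed.

Lemma homog_map_mpoly j (p : {mpoly k[m]}) : p \is j.-homog -> map_mpoly f p \is j.-homog.
Proof.
move=> hp; apply/dhomogP => M; rewrite mcoeff_msupp mcoeff_map_mpoly fmorph_eq0.
by rewrite -mcoeff_msupp; apply: (dhomog_mf hp).
Qed.

Lemma reduction_field_extension j (p : {mpoly k[m]}) : (0 < j)%N -> p \is j.-homog ->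
  reduction_ideal D theta p <-> reduction_ideal D thetaK (map_mpoly f p).
Proof.
move=> j0 hp; rewrite (ideal_mxP _ j0) // (ideal_mxP _ j0) ?homog_map_mpoly //.
by rewrite map_ideal_mx map_mpoly_row map_submx.
Qed.

End FieldExtension.

(** * Relabelling the vertices *)

(** Variables outside the image of [e] are non-faces, so that adding them does not
    change the reduction. *)
Section VertexRenaming.
Variables (K : fieldType) (d m N : nat) (e : 'I_m -> 'I_N) (inj_e : injective e).
Variables (a : 'M[K]_(d, m)) (b : 'M[K]_(d, N)).
Hypothesis ab : forall l j, a l j = b l (e j).
Variables (D : {set {set 'I_m}}) (E : {set {set 'I_N}}).
Hypothesis DE : forall s : {set 'I_m}, (s \in D) = ((e @: s) \in E).
Hypothesis E_im : forall s : {set 'I_N}, s \in E -> s \subset codom e.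
Local Notation I := (reduction_ideal D (matrix_forms a)).
Local Notation J := (reduction_ideal E (matrix_forms b)).

Let up_vars := [tuple ('X_(e j) : {mpoly K[N]}) | j < m].
Let down_vars := [tuple (if [pick i | e i == j] is Some i
                         then 'X_i else 0 : {mpoly K[m]}) | j < N].

Definition rename_up : {mpoly K[m]} -> {mpoly K[N]} := comp_mpoly up_vars.
Definition rename_down : {mpoly K[N]} -> {mpoly K[m]} := comp_mpoly down_vars.

HB.instance Definition _ := GRing.RMorphism.copy rename_up (comp_mpoly up_vars).
HB.instance Definition _ := GRing.RMorphism.copy rename_down (comp_mpoly down_vars).

Lemma comp_mpoly_homog n1 n2 (h : n1.-tuple {mpoly K[n2]}) i (p : {mpoly K[n1]}) :
  (forall j, tnth h j \is 1.-homog) -> p \is i.-homog -> p \mPo h \is i.-homog.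
Proof.
move=> h1; move: p; apply: homog_ind.
- by rewrite raddf0 rpred0.
- by move=> p q hp hq; rewrite raddfD rpredD.
move=> c M <-; rewrite comp_mpolyZ rpredZ // comp_mpolyX mdegE.
apply: (big_ind2 (fun (q : {mpoly K[n2]}) n => q \is n.-homog)).
- exact: dhomog1.
- by move=> q1 n q2 n' h_q1 h_q2; apply: dhomogM.
by move=> j _; have := dhomogMn (M j) (h1 j); rewrite mul1n.
Qed.

Lemma rename_upX j : rename_up 'X_j = 'X_(e j).
Proof. by rewrite /rename_up comp_mpolyXU -tnth_nth tnth_mktuple. Qed.

Lemma rename_downX j : rename_down 'X_(e j) = 'X_j.
Proof.
rewrite /rename_down comp_mpolyXU -tnth_nth tnth_mktuple.
by case: pickP => [i /eqP/inj_e->|/(_ j)]; rewrite ?eqxx.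
Qed.

Lemma rename_downX0 j : j \notin codom e -> rename_down 'X_j = 0.
Proof.
move=> je; rewrite /rename_down comp_mpolyXU -tnth_nth tnth_mktuple.
by case: pickP => // i /eqP ij; rewrite -ij codom_f in je.
Qed.

Lemma rename_upZ c p : rename_up (c *: p) = c *: rename_up p.
Proof. exact: comp_mpolyZ. Qed.

Lemma rename_downZ c p : rename_down (c *: p) = c *: rename_down p.
Proof. exact: comp_mpolyZ. Qed.

Lemma rename_up_homog i p : p \is i.-homog -> rename_up p \is i.-homog.
Proof.
apply: comp_mpoly_homog => j; rewrite tnth_mktuple.
by rewrite dhomogX; apply/eqP/mdeg1.
Qed.

Lemma rename_down_homog i p : p \is i.-homog -> rename_down p \is i.-homog.
Proof.
apply: comp_mpoly_homog => j; rewrite tnth_mktuple; case: pickP => [l _|_].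
  by rewrite dhomogX; apply/eqP/mdeg1.
exact: rpred0.
Qed.

Lemma rename_upK : cancel rename_up rename_down.
Proof.
move=> p; rewrite [LHS](congr1 (rename_down \o rename_up) (mpolyE p)) [RHS]mpolyE /=.
rewrite (rmorph_sum rename_up) (rmorph_sum rename_down) /=; apply: eq_bigr => M _.
rewrite rename_upZ rename_downZ; congr (_ *: _).
rewrite mpolyXE_id (rmorph_prod rename_up) (rmorph_prod rename_down) /=.
apply: eq_bigr => j _ /=.
by rewrite !rmorphXn /= rename_upX rename_downX.
Qed.

Lemma outside_reduction j : j \notin codom e -> J 'X_j.
Proof.
move=> je; apply: (@reduction_nonface _ _ _ _ _ [set j]).
  by apply: contra je => /E_im/subsetP; apply; apply: set11.
by rewrite mnm_supportU.
Qed.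

Lemma rename_downK_mod q : J (rename_up (rename_down q) - q).
Proof.
have JM p r : J (rename_up (rename_down p) - p) ->
    J (rename_up (rename_down r) - r) ->
    J (rename_up (rename_down (p * r)) - p * r).
  move=> Jp Jr; rewrite !rmorphM /=.
  have := reductionD (reductionMl (rename_up (rename_down p)) Jr) (reductionMl r Jp).
  by congr (J _); ring.
rewrite (mpolyE q) (rmorph_sum rename_down) (rmorph_sum rename_up) -sumrB /=.
apply: reduction_sum => M _.
rewrite rename_downZ rename_upZ -scalerBr; apply: reductionZ.
rewrite mpolyXE_id; elim/big_ind: _ => // [|j _].
  by rewrite !rmorph1 subrr; apply: reduction0.
elim: (M j) => [|k IH]; first by rewrite !expr0 !rmorph1 subrr; apply: reduction0.
rewrite exprS; apply: JM => //; case: (boolP (j \in codom e)) => [/codomP[i ->]|je].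
  by rewrite rename_downX rename_upX subrr; apply: reduction0.
by rewrite rename_downX0 // rmorph0 sub0r; apply/reductionN/outside_reduction.
Qed.

Lemma rename_up_reduction p : I p -> J (rename_up p).
Proof.
case=> [c [c' /eqP]]; rewrite subr_eq => /eqP->.
rewrite rmorphD !(rmorph_sum rename_up); apply: reductionD; apply: reduction_sum => /=.
  move=> s sD; rewrite rmorphM rmorph_prod /=; apply: reductionMl.
  under eq_bigr do rewrite rename_upX.
  have -> : \prod_(j in s) 'X_(e j) = 'X_[squarefree_mnm (e @: s)] :> {mpoly K[N]}.
    by rewrite -prod_vars_squarefree big_imset //= => ? ? _ _ /inj_e.
  rewrite DE in sD; apply: (reduction_nonface _ sD).
  by rewrite mnm_support_squarefree.
move=> l _; rewrite rmorphM /=; apply: reductionMl.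
have -> : rename_up (matrix_forms a l) =
    matrix_forms b l - \sum_(j | j \notin codom e) b l j *: 'X_j.
  rewrite [matrix_forms b l](bigID (mem (codom e))) /= addrK (rmorph_sum rename_up) /=.
  rewrite (eq_bigl (mem [set e j | j in setT])) => [|j]; last first.
    by apply/idP/imsetP => [/codomP[i ->]|[i _ ->]]; [exists i | apply: codom_f].
  rewrite big_imset /=; last by move=> ? ? _ _ /inj_e.
  apply: eq_big => [j|j _]; first by rewrite inE.
  by rewrite rename_upZ rename_upX ab.
apply: reductionB; first exact: reduction_theta.
by apply: reduction_sum => j je; apply/reductionZ/outside_reduction.
Qed.

Lemma rename_down_reduction q : J q -> I (rename_down q).
Proof.
case=> [c [c' /eqP]]; rewrite subr_eq => /eqP->.
rewrite rmorphD !(rmorph_sum rename_down); apply: reductionD; apply: reduction_sum => /=.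
  move=> s sE; rewrite rmorphM rmorph_prod /=; apply: reductionMl.
  case: (boolP (s \subset codom e)) => [se|/subsetPn[j js je]]; last first.
    by rewrite (bigD1 j) //= rename_downX0 // mul0r; apply: reduction0.
  have defs : s = e @: (e @^-1: s).
    apply/setP=> j; apply/idP/imsetP => [js|[i]]; last by rewrite inE => ? ->.
    by have /codomP[i ji] := subsetP se _ js; exists i; rewrite // inE -ji.
  rewrite {1}defs big_imset /=; last by move=> ? ? _ _ /inj_e.
  under eq_bigr do rewrite rename_downX.
  rewrite prod_vars_squarefree; rewrite defs -DE in sE.
  by apply: (reduction_nonface _ sE); rewrite mnm_support_squarefree.
move=> l _; rewrite rmorphM /=; apply: reductionMl.
have -> : rename_down (matrix_forms b l) = matrix_forms a l.
  rewrite [matrix_forms b l](bigID (mem (codom e))) /= rmorphD.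
  rewrite !(rmorph_sum rename_down) /=.
  rewrite [X in _ + X]big1 ?addr0 => [|j je]; last first.
    by rewrite rename_downZ rename_downX0 // scaler0.
  rewrite (eq_bigl (mem [set e j | j in setT])) => [|j]; last first.
    by apply/idP/imsetP => [/codomP[i ->]|[i _ ->]]; [exists i | apply: codom_f].
  rewrite big_imset /=; last by move=> ? ? _ _ /inj_e.
  apply: eq_big => [j|j _]; first by rewrite inE.
  by rewrite rename_downZ rename_downX ab.
exact: reduction_theta.
Qed.

Lemma rename_up_reductionP p : I p <-> J (rename_up p).
Proof.
by split=> [/rename_up_reduction//|/rename_down_reduction]; rewrite rename_upK.
Qed.

Lemma nondegenerate_renaming i :
  nondegenerate_in D (matrix_forms a) i -> nondegenerate_in E (matrix_forms b) i.
Proof.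
move=> nd u hu uJ; have Iu : I (rename_down u).
  apply: nd (rename_down_homog hu) _ => v /rename_up_homog/uJ/rename_down_reduction.
  by rewrite rmorphM /= rename_upK.
rewrite -[u](subKr (rename_up (rename_down u))).
exact: reductionB (rename_up_reduction Iu) (rename_downK_mod u).
Qed.

End VertexRenaming.

(** * Anisotropy and nondegeneracy *)

Section AnisotropyNondegeneracy.
Variables (K : fieldType) (m n : nat) (D : {set {set 'I_m}}).
Variable theta : 'I_(2 * n) -> {mpoly K[m]}.
Local Notation I := (reduction_ideal D theta).

(** A class of positive degree whose products with all variables vanish has
    square zero. Climbing one degree at a time, a nonzero class of degree [i] thus
    has a nonzero multiple in degree [n], whose square is a nonzero multiple of
    the given class in degree [2 * n]. *)
Lemma anisotropic_nondegenerate i : anisotropic D theta -> (0 < i <= n)%N ->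
  nondegenerate_in D theta i.
Proof.
move=> an /andP[i0 iLn].
have sq j u : (j <= n)%N -> u \is j.-homog -> I (u * u) -> I u.
  move=> jn hu Iuu; apply: NNPP => nIu.
  by apply: (an j u _ hu nIu); rewrite ?expr2 // leq_mul2l.
move: {2}(n - i)%N (erefl (n - i)%N) => k.
elim: k i i0 iLn => [|k IH] i i0 iLn dk u hu uI.
  have Ei : i = n by apply/eqP; rewrite eqn_leq iLn -subn_eq0 dk.
  apply: (sq i) => //; apply: uI; suff -> : (2 * n - i)%N = i by [].
  by rewrite Ei mul2n -addnn addnK.
have iltn : (i < n)%N by rewrite -subn_gt0 dk.
have uX j : I (u * 'X_j).
  have hX : 'X_j \is [in K[m], 1.-homog] by rewrite dhomogX; apply/eqP/mdeg1.
  apply: (IH i.+1) => //; first by rewrite subnS dk.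
    by rewrite -addn1; apply: dhomogM.
  move=> v hv; rewrite -mulrA; apply: uI.
  have -> : (2 * n - i = 1 + (2 * n - i.+1))%N.
    by rewrite subnS add1n prednK // subn_gt0 (leq_trans iltn) // leq_pmull.
  exact: dhomogM.
apply: (sq i) => //; rewrite {2}(mpolyE u) mulr_sumr big_seq.
apply: reduction_sum => M /(dhomog_mf hu) dM.
have [|j [M' ->]] := @mdeg_neq0_factor _ M; first by rewrite dM -lt0n.
rewrite -scalerAr mpolyXD mulrA; exact/reductionZ/reductionMr.
Qed.

End AnisotropyNondegeneracy.

Lemma sqr_sum_pchar2 (R : comNzRingType) (charR : (2 \in [pchar R])%R)
    (J : Type) (r : seq J) (P : pred J) (F : J -> R) :
  (\sum_(x <- r | P x) F x) ^+ 2 = \sum_(x <- r | P x) F x ^+ 2.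
Proof.
apply: (big_morph (fun x : R => x ^+ 2)) => [x y|]; last by rewrite expr0n.
by rewrite sqrrD mulrn_pchar // addr0.
Qed.

Lemma mnm_sum_vars m d (P : 'X_{1..m}) : mdeg P = d ->
  exists h : {ffun 'I_d -> 'I_m}, P = (\sum_l U_(h l))%MM.
Proof.
suff H : mdeg P = d -> exists t : d.-tuple 'I_m, P = (\sum_(v <- t) U_(v))%MM.
  by case/H=> t ->; exists [ffun l => tnth t l]; rewrite big_tuple;
     apply: eq_bigr => l _; rewrite ffunE.
elim: d P => [|d IH] P dP.
  by exists [tuple]; rewrite big_nil; apply/eqP; rewrite -mdeg_eq0 dP.
have [|v [P' defP]] := @mdeg_neq0_factor _ P; first by rewrite dP.
have [|t defP'] := IH P'; last by exists [tuple of v :: t]; rewrite big_cons defP defP'.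
by apply/eqP; rewrite -eqSS -dP defP mdegD mdeg1.
Qed.

Section FrobeniusTrace.
Variables (K : fieldType) (charK : (2 \in [pchar K])%R) (m d : nat).
Variables (D : {set {set 'I_m}}) (a : 'M[K]_(d, m)).
Local Notation theta := (matrix_forms a).
Local Notation I := (reduction_ideal D theta).
Variable psi : {mpoly K[m]} -> K.
Hypothesis psi_linear : forall c p q, psi (c *: p + q) = c * psi p + psi q.
Hypothesis psi_ideal : forall p, I p -> psi p = 0.

Definition mnm_even (M : 'X_{1..m}) : bool := [forall j, ~~ odd (M j)].
Definition mnm_half (M : 'X_{1..m}) : 'X_{1..m} := [multinom (M j)./2 | j < m].

Definition trace_mnm (M : 'X_{1..m}) : K :=
  if mnm_even M then psi 'X_[mnm_half M] ^+ 2 else 0.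

(** The composite of [psi] with the trace of the Frobenius map, which keeps the
    even monomials and halves their exponents; the square in [trace_mnm] makes it
    linear over [K]. *)
Definition frobenius_trace (p : {mpoly K[m]}) : K :=
  \sum_(M <- msupp p) p@_M * trace_mnm M.

Lemma mpoly_pchar2 : (2 \in [pchar {mpoly K[m]}])%R.
Proof. exact: (rmorph_pchar (mpolyC m (R := K)) charK). Qed.

Lemma frobenius_traceE p k : (msize p <= k)%N ->
  frobenius_trace p = \sum_(M : 'X_{1..m < k}) p@_M * trace_mnm M.
Proof.
move=> pk; rewrite /frobenius_trace (big_mksub 'X_{1..m < k}) ?msupp_uniq //=; last first.
  by move=> M /msize_mdeg_lt /leq_trans; apply.
by rewrite big_rmcond //= => M /memN_msupp_eq0 ->; rewrite mul0r.
Qed.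

Lemma frobenius_traceD p q :
  frobenius_trace (p + q) = frobenius_trace p + frobenius_trace q.
Proof.
pose k := (msize p + msize q)%N.
rewrite !(@frobenius_traceE _ k) ?leq_addl ?leq_addr //; last first.
  by apply: leq_trans (msizeD_le _ _) _; rewrite geq_max leq_addl leq_addr.
by rewrite -big_split; apply: eq_bigr => M _; rewrite mcoeffD mulrDl.
Qed.

Lemma frobenius_trace0 : frobenius_trace 0 = 0.
Proof. by rewrite /frobenius_trace msupp0 big_nil. Qed.

Lemma frobenius_traceZ c p : frobenius_trace (c *: p) = c * frobenius_trace p.
Proof.
rewrite (@frobenius_traceE _ (msize p)) ?msizeZ_le //.
rewrite (@frobenius_traceE p (msize p)) // mulr_sumr.
by apply: eq_bigr => M _; rewrite mcoeffZ mulrA.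
Qed.

Lemma frobenius_traceX M : frobenius_trace 'X_[M] = trace_mnm M.
Proof. by rewrite /frobenius_trace msuppX big_seq1 mcoeffX eqxx mul1r. Qed.

Lemma frobenius_trace_sum J (r : seq J) (P : pred J) (F : J -> {mpoly K[m]}) :
  frobenius_trace (\sum_(x <- r | P x) F x) = \sum_(x <- r | P x) frobenius_trace (F x).
Proof. exact: (big_morph _ frobenius_traceD frobenius_trace0). Qed.

Lemma psi0 : psi 0 = 0.
Proof. exact/psi_ideal/reduction0. Qed.

Lemma psi_sum J (r : seq J) (c : J -> K) (F : J -> {mpoly K[m]}) :
  psi (\sum_(x <- r) c x *: F x) = \sum_(x <- r) c x * psi (F x).
Proof.
elim: r => [|x r IH]; first by rewrite !big_nil psi0.
by rewrite !big_cons psi_linear IH.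
Qed.

Lemma mnm_even_add2 (L M : 'X_{1..m}) : mnm_even (L *+ 2 + M) = mnm_even M.
Proof.
by apply: eq_forallb => j; rewrite mnmDE mulmnE oddD muln2 odd_double.
Qed.

Lemma mnm_half_add2 (L M : 'X_{1..m}) : mnm_half (L *+ 2 + M) = (L + mnm_half M)%MM.
Proof.
apply/mnmP=> j; rewrite mnmE mnmDE mulmnE mnmDE mnmE muln2.
by rewrite halfD odd_double /= doubleK.
Qed.

Lemma frobenius_trace_sqr u M :
  frobenius_trace (u ^+ 2 * 'X_[M]) =
  if mnm_even M then psi (u * 'X_[mnm_half M]) ^+ 2 else 0.
Proof.
have -> : u ^+ 2 * 'X_[M] =
    \sum_(L <- msupp u) (u@_L ^+ 2) *: 'X_[(L *+ 2 + M)%MM].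
  rewrite {1}(mpolyE u) (sqr_sum_pchar2 mpoly_pchar2) mulr_suml.
  by apply: eq_bigr => L _; rewrite exprZn mpolyXn -scalerAl -mpolyXD.
rewrite frobenius_trace_sum.
under eq_bigr do rewrite frobenius_traceZ frobenius_traceX /trace_mnm mnm_even_add2.
case: ifP => evM; last by rewrite big1 // => L _; rewrite mulr0.
have -> : u * 'X_[mnm_half M] =
    \sum_(L <- msupp u) u@_L *: 'X_[(L + mnm_half M)%MM].
  rewrite {1}(mpolyE u) mulr_suml.
  by apply: eq_bigr => L _; rewrite -scalerAl -mpolyXD.
rewrite psi_sum (sqr_sum_pchar2 charK).
by apply: eq_bigr => L _; rewrite mnm_half_add2 exprMn.
Qed.

(** Multiplying by the product of all parameters turns every parameter in a
    member of the ideal into a square, and [theta_l ^+ 2] passes through the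
    Frobenius trace as [theta_l]. *)
Lemma frobenius_trace_ideal q : I q ->
  frobenius_trace (\prod_l theta l * q) = 0.
Proof.
case=> [b [c /eqP]]; rewrite subr_eq => /eqP->.
rewrite mulrDr frobenius_traceD !mulr_sumr !frobenius_trace_sum.
rewrite [X in X + _]big1 ?add0r => [|s sD]; last first.
  rewrite mulrA prod_vars_squarefree; set r := _ * c s.
  rewrite (mpolyE r) mulr_suml frobenius_trace_sum big1 // => M _.
  rewrite -scalerAl frobenius_traceZ -mpolyXD frobenius_traceX /trace_mnm.
  case: ifP => [/forallP ev|_]; last by rewrite mulr0.
  rewrite psi_ideal ?expr0n ?mulr0 //; apply: (reduction_nonface _ sD).
  apply/subsetP=> j js; rewrite inE mnmE; have := ev j.
  by rewrite mnmDE mnmE js addn1; case: (M j) => // -[].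
rewrite big1 // => l _.
have -> : \prod_l theta l * (b l * theta l) =
    (theta l ^+ 2) * (\prod_(i | i != l) theta i * b l).
  by rewrite (bigD1 l) //=; ring.
rewrite [X in _ * X](mpolyE (_ * b l)) mulr_sumr frobenius_trace_sum big1 // => M _.
rewrite -scalerAr frobenius_traceZ frobenius_trace_sqr psi_ideal.
  by rewrite expr0n; case: ifP; rewrite mulr0.
exact/reductionMr/reduction_theta.
Qed.

Lemma frobenius_trace_expansion u M : I (u ^+ 2) ->
  \sum_(h : {ffun 'I_d -> 'I_m}) (\prod_l a l (h l)) *
    (if mnm_even (\sum_l U_(h l) + M)%MM
     then psi (u * 'X_[mnm_half (\sum_l U_(h l) + M)%MM]) else 0) ^+ 2 = 0.
Proof.
move=> Iu; have := frobenius_trace_ideal (reductionMr 'X_[M] Iu).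
rewrite /matrix_forms /linear_form bigA_distr_bigA /= mulr_suml frobenius_trace_sum.
move=> E; rewrite -[RHS]E; apply: eq_bigr => h _.
have -> : \prod_i (a i (h i) *: 'X_(h i)) =
    (\prod_i a i (h i)) *: 'X_[(\sum_i U_(h i))%MM] :> {mpoly K[m]}.
  by rewrite scaler_prod mprodXE.
rewrite -scalerAl ['X_[_] * _]mulrCA -mpolyXD frobenius_traceZ frobenius_trace_sqr.
by case: ifP => // _; rewrite expr0n.
Qed.

End FrobeniusTrace.

Section NondegenerateAnisotropic.
Variables (K : fieldType) (charK : (2 \in [pchar K])%R) (m d : nat).
Variables (D : {set {set 'I_m}}) (Dc : down_closed D) (a : 'M[K]_(d, m)).
Local Notation theta := (matrix_forms a).
Local Notation I := (reduction_ideal D theta).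

(** Stands in for differentiation with respect to the entries of [a], for which
    squares are constants in characteristic 2. *)
Definition square_independent : Prop :=
  forall c : {ffun 'I_d -> 'I_m} -> K,
    \sum_(h : {ffun 'I_d -> 'I_m}) (\prod_l a l (h l)) * c h ^+ 2 = 0 ->
    forall h, c h = 0.

Lemma reduction_sqr_const u : u \is 0.-homog -> I (u ^+ 2) -> I u.
Proof.
move=> hu Iu2; have [c defu] : exists c, u = c%:MP_[m].
  exists u@_0%MM; apply/msize1_polyC; rewrite msizeE.
  by apply/bigmax_leqP_seq => M /(dhomog_mf hu) ->.
have [c0|c0] := eqVneq c 0; first by rewrite defu c0 mpolyC0; apply: reduction0.
have := reductionZ c^-1 Iu2.
by rewrite defu expr2 -mul_mpolyC -!mpolyCM mulKf.
Qed.

(** Suppose that [u ^+ 2] is in the ideal. For a functional [psi] that kills the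
    ideal, the identity [frobenius_trace_expansion] for [u] and a monomial [M] is
    a linear relation with square coefficients between products of entries of
    [a], so that all these coefficients vanish: they are the values of [psi] at
    [u] times the square roots of the monomials divisible by [M]. Every monomial
    [L] of degree [d - i] is such a square root, for a factor [M] of degree
    [d - 2 * i] of [L], whence [psi (u * 'X_[L]) = 0] for all [psi] and [L]. *)
Lemma nondegenerate_anisotropic : (0 < d)%N -> square_independent ->
  (forall i, (0 < i)%N -> (2 * i <= d)%N -> nondegenerate_in D theta i) ->
  anisotropic D theta.
Proof.
move=> d0 ind nd i u id hu nIu Iu2; apply: nIu.
case: (posnP i) hu id => [->|i0] hu id; first exact: reduction_sqr_const.
apply: (nd i) => //; apply: homog_ind.
- by rewrite mulr0; apply: reduction0.
- by move=> p q Ip Iq; rewrite mulrDr; apply: reductionD.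
move=> e L dL; rewrite -scalerAr; apply: reductionZ.
have di : (i <= d)%N by apply: leq_trans id; rewrite leq_pmull.
apply: (@reduction_separation _ _ d D a d) => //.
  by rewrite -(subnKC di); apply: dhomogM => //; rewrite dhomogX /= dL.
move=> psi psi_lin psi_ideal.
have [|M [M' [defL dM]]] := @mdeg_split _ L (d - 2 * i).
  by rewrite dL leq_sub2l // leq_pmull.
have dM' : mdeg M' = i.
  have := congr1 mdeg defL; rewrite mdegD dM dL => E.
  apply/eqP; rewrite -(eqn_add2l (d - 2 * i)) -E.
  by rewrite mul2n -addnn subnDA subnK // leq_subRL // addnn -mul2n.
(* The product of the variables [h l] is [L ^+ 2] divided by [M]. *)
have [|h hP] := @mnm_sum_vars m d (M' *+ 2 + M)%MM.
  by rewrite mdegD mdegMn dM' dM mulnC subnKC.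
have := ind _ (frobenius_trace_expansion charK psi_lin psi_ideal M Iu2) h.
rewrite -hP; have -> : (M' *+ 2 + M + M = L *+ 2 + 0)%MM.
  by rewrite defL addm0; apply/mnmP=> j; rewrite !(mnmDE, mulmnE) !muln2 -!addnn; ring.
rewrite mnm_even_add2 mnm_half_add2.
have -> : mnm_even (0%MM : 'X_{1..m}) by apply/forallP=> j; rewrite mnm0E.
by have -> : (L + mnm_half 0 = L)%MM by apply/mnmP=> j; rewrite mnmDE mnmE mnm0E addn0.
Qed.

End NondegenerateAnisotropic.

(** * Generic coefficients *)

Local Notation "x %:F" := (FracField.tofrac x).

Section Fractions.
Variables R S : idomainType.

Lemma fraction_numden (x : {fraction R}) :
  exists2 d, d != 0 & exists n, x * d%:F = n%:F.
Proof.
elim/quotW: x => y; exists \d_y; first exact: denom_ratioP.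
exists \n_y; unlock FracField.tofrac; rewrite -[LHS]FracField.pi_mul.
apply/eqmodP; rewrite /= FracField.equivfE /FracField.mulf.
rewrite !numden_Ratio ?mulf_neq0 ?oner_neq0 ?denom_ratioP //.
by rewrite !mulr1 mulrC.
Qed.

Lemma common_denominator (J : finType) (c : J -> {fraction R}) :
  exists2 d, d != 0 & exists n : J -> R, forall j, c j * d%:F = (n j)%:F.
Proof.
have /fin_all_exists[q qP] : forall j, exists q, q != 0 /\ exists n, c j * q%:F = n%:F.
  by move=> j; have [q q0 nP] := fraction_numden (c j); exists q.
exists (\prod_j q j); first by apply/prodf_neq0 => j _; case: (qP j).
have /fin_all_exists[n nP] : forall j, exists n, c j * (\prod_j q j)%:F = n%:F.
  move=> j; have [_ [n nP]] := qP j; exists (n * \prod_(i | i != j) q i).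
  by rewrite (bigD1 j) //= !tofracM mulrA nP.
by exists n.
Qed.

Variable g : {rmorphism R -> S}.
Hypothesis g_inj : injective g.

Definition fraction_map (x : {fraction R}) : {fraction S} :=
  (g \n_(repr x))%:F / (g \d_(repr x))%:F.

Lemma fraction_mapP x n d : d != 0 -> x * d%:F = n%:F ->
  fraction_map x * (g d)%:F = (g n)%:F.
Proof.
move=> d0 xd; have qd : \d_(repr x) != 0 by apply: denom_ratioP.
have xq : x * (\d_(repr x))%:F = (\n_(repr x))%:F.
  rewrite -{1}[x]reprK; unlock FracField.tofrac; rewrite -[LHS]FracField.pi_mul.
  apply/eqmodP; rewrite /= FracField.equivfE /FracField.mulf.
  rewrite !numden_Ratio ?mulf_neq0 ?oner_neq0 ?denom_ratioP //.
  by rewrite !mulr1 mulrC.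
have gE u : u != 0 -> (g u)%:F != 0.
  by move=> u0; rewrite tofrac_eq0 (raddf_eq0 _ g_inj).
have E : n * \d_(repr x) = \n_(repr x) * d.
  by apply/eqP; rewrite -tofrac_eq !tofracM -xd -xq mulrAC.
rewrite /fraction_map mulrAC; apply: (canLR (mulfK (gE _ qd))).
by rewrite -!tofracM -!rmorphM E.
Qed.

Lemma fraction_map_eq x n d : d != 0 -> x * d%:F = n%:F ->
  fraction_map x = (g n)%:F / (g d)%:F.
Proof.
move=> d0 /(fraction_mapP d0) <-; rewrite mulfK //.
by rewrite tofrac_eq0 (raddf_eq0 _ g_inj).
Qed.

Lemma fraction_map_zmod : zmod_morphism fraction_map.
Proof.
move=> x y; have [q q0 [n nP]] := fraction_numden x.
have [r r0 [k kP]] := fraction_numden y.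
have gE u : u != 0 -> (g u)%:F != 0 by move=> u0; rewrite tofrac_eq0 (raddf_eq0 _ g_inj).
rewrite (fraction_map_eq q0 nP) (fraction_map_eq r0 kP).
rewrite (@fraction_map_eq _ (n * r - k * q) (q * r)) ?mulf_neq0 //; last first.
  rewrite tofracB !tofracM mulrBl mulrA nP -kP; congr (_ - _).
  by rewrite [RHS]mulrAC mulrA.
rewrite rmorphB !rmorphM tofracB !tofracM -[in RHS]mulNr addf_div ?gE //.
by rewrite mulNr.
Qed.

Lemma fraction_map_monoid : monoid_morphism fraction_map.
Proof.
have gE u : u != 0 -> (g u)%:F != 0 by move=> u0; rewrite tofrac_eq0 (raddf_eq0 _ g_inj).
split.
  by rewrite (@fraction_map_eq _ 1 1) ?oner_neq0 ?mulr1 // rmorph1 divff ?oner_neq0.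
move=> x y; have [q q0 [n nP]] := fraction_numden x.
have [r r0 [k kP]] := fraction_numden y.
rewrite (fraction_map_eq q0 nP) (fraction_map_eq r0 kP).
rewrite (@fraction_map_eq _ (n * k) (q * r)) ?mulf_neq0 //; last first.
  by rewrite !tofracM mulrACA nP kP.
by rewrite mulf_div !rmorphM.
Qed.

Lemma fraction_rmorphism :
  exists f : {rmorphism {fraction R} -> {fraction S}}, forall r, f r%:F = (g r)%:F.
Proof.
pose fZ := GRing.isZmodMorphism.Build _ _ fraction_map fraction_map_zmod.
pose fM := GRing.isMonoidMorphism.Build _ _ fraction_map fraction_map_monoid.
pose f : {rmorphism {fraction R} -> {fraction S}} := HB.pack fraction_map fZ fM.
exists f => r; rewrite /f /= (@fraction_map_eq _ r 1) ?oner_neq0 ?mulr1 //.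
by rewrite rmorph1 divr1.
Qed.

End Fractions.

Section GenericMatrix.
Variables (F : fieldType) (d N : nat).
Local Notation R := {mpoly F[d * N]}.

Definition generic_var (l : 'I_d) (j : 'I_N) : R := 'X_(mxvec_index l j).

Definition generic_mx : 'M[{fraction R}]_(d, N) := \matrix_(l, j) (generic_var l j)%:F.

Definition generic_point (A : 'I_d -> 'I_N -> F) (x : 'I_(d * N)) : F :=
  (mxvec (\matrix_(l, j) A l j)) 0 x.

Lemma meval_generic_var A l j : (generic_var l j).@[generic_point A] = A l j.
Proof. by rewrite mevalXU /generic_point mxvecE mxE. Qed.

Lemma mxvec_index_inj (l l' : 'I_d) (j j' : 'I_N) :
  mxvec_index l j = mxvec_index l' j' -> l = l' /\ j = j'.
Proof. by move/cast_ord_inj/enum_rank_inj => [-> ->]. Qed.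

Lemma generic_pchar : (2 \in [pchar F])%R -> (2 \in [pchar {fraction R}])%R.
Proof.
move=> cF; have := rmorph_pchar (mpolyC (d * N) (R := F)) cF.
exact: (rmorph_pchar (@FracField.tofrac R)).
Qed.

Lemma generic_general_position : general_position generic_mx.
Proof.
move=> s cs; have [h [hinj hs]] := enumeration_exists cs.
have -> : set_det generic_mx s =
    (\sum_(g : {ffun 'I_d -> 'I_N} | [set g i | i : 'I_d] == s)
       \prod_l generic_var l (g l))%:F.
  rewrite rmorph_sum; apply: eq_bigr => g _; rewrite rmorph_prod.
  by apply: eq_bigr => l _; rewrite mxE.
(* At the point where the columns of [s] form a permutation matrix only the
   enumeration [h] survives. *)
rewrite tofrac_eq0; apply/eqP.
move/(congr1 (meval (generic_point (fun l j => (h l == j)%:R)))).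
rewrite meval0 raddf_sum (bigD1 h) ?hs //= [X in _ + X]big1 => [|g /andP[_ gh]].
  rewrite addr0 rmorph_prod big1 => [/eqP|l _]; first by rewrite oner_eq0.
  by rewrite /= meval_generic_var eqxx.
have /existsP[l hgl] : [exists l, h l != g l].
  apply: contraNT gh; rewrite negb_exists => /forallP E.
  by apply/eqP/ffunP=> l; have /eqP := negbNE (E l).
by rewrite rmorph_prod (bigD1 l) //= meval_generic_var (negPf hgl) mul0r.
Qed.

(** After clearing denominators the coefficients are squares of polynomials, with
    even exponents only, so that the terms of the sum have monomials of different
    parities and cannot cancel. *)
Lemma generic_square_independent : (2 \in [pchar F])%R ->
  square_independent generic_mx.
Proof.
move=> cF c c0 h0.
have [q q0 [n nP]] := common_denominator c.
pose mon (h : {ffun 'I_d -> 'I_N}) := (\sum_l U_(mxvec_index l (h l)))%MM.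
have n0 : \sum_(h : {ffun 'I_d -> 'I_N}) 'X_[mon h] * n h ^+ 2 = 0 :> R.
  apply/eqP; rewrite -tofrac_eq0; apply/eqP.
  have := congr1 (fun x => x * q%:F ^+ 2) c0; rewrite mul0r => <-.
  rewrite rmorph_sum mulr_suml; apply: eq_bigr => h _ /=.
  rewrite -mulrA -exprMn nP -mprodXE rmorphM rmorphXn rmorph_prod /=.
  by congr (_ * _); apply: eq_bigr => l _; rewrite mxE.
have coef M (p : R) L : ('X_[M] * p ^+ 2)@_L =
    \sum_(P <- msupp p) p@_P ^+ 2 * ((M + P *+ 2)%MM == L)%:R.
  rewrite {1}(mpolyE p) sqr_sum_pchar2; last first.
    exact: (rmorph_pchar (mpolyC (d * N) (R := F)) cF).
  rewrite mulr_sumr raddf_sum; apply: eq_bigr => P _ /=.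
  by rewrite exprZn mpolyXn -scalerAr -mpolyXD mcoeffZ mcoeffX.
have mon_odd h l : odd (mon h (mxvec_index l (h0 l))) = (h l == h0 l).
  rewrite mnm_sumE (bigD1 l) //= big1 => [|l' ll'].
    rewrite addn0 mnm1E oddb; apply/eqP/eqP => [|->//].
    by case/mxvec_index_inj.
  rewrite mnm1E; case: eqP => // /mxvec_index_inj[E _].
  by rewrite E eqxx in ll'.
have odd_add2 (A B : 'X_{1..d * N}) x : odd ((A + B *+ 2)%MM x) = odd (A x).
  by rewrite mnmDE mulmnE muln2 oddD odd_double addbF.
have nh0 : n h0 = 0.
  apply/mpolyP=> P; rewrite mcoeff0.
  have := congr1 (mcoeff (mon h0 + P *+ 2)%MM) n0; rewrite mcoeff0 raddf_sum.
  rewrite (bigD1 h0) //= big1 ?addr0 => [|h hh0].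
    rewrite coef; case: (boolP (P \in msupp (n h0))) => [PS|/memN_msupp_eq0->//].
    rewrite (bigD1_seq P) ?msupp_uniq //= eqxx mulr1 big1 ?addr0 => [|Q QP].
      by move/eqP; rewrite expf_eq0 => /eqP.
    rewrite eqm_add2l; case: eqP => [E|_]; last by rewrite mulr0.
    case/eqP: QP; apply/mnmP=> x; have := congr1 (fun M : 'X_{1..d * N} => M x) E.
    by rewrite !mulmnE !muln2 => /double_inj.
  have /existsP[l hl] : [exists l, h l != h0 l].
    apply: contraNT hh0; rewrite negb_exists => /forallP E.
    by apply/eqP/ffunP=> l; have /eqP := negbNE (E l).
  rewrite coef big1 // => Q _; case: eqP => [E|_]; last by rewrite mulr0.
  have := congr1 (fun M : 'X_{1..d * N} => odd (M (mxvec_index l (h0 l)))) E.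
  by rewrite !odd_add2 !mon_odd eqxx (negPf hl).
have /eqP := nP h0; rewrite nh0 tofrac0 mulf_eq0 tofrac_eq0 (negPf q0) orbF.
by move/eqP.
Qed.

End GenericMatrix.

Lemma generic_field_embedding (F : fieldType) d m N (e : 'I_m -> 'I_N) :
  injective e ->
  exists f : {rmorphism {fraction {mpoly F[d * m]}} -> {fraction {mpoly F[d * N]}}},
    forall l j, f (generic_mx F d m l j) = generic_mx F d N l (e j).
Proof.
move=> inj_e.
pose up := [tuple mxvec (\matrix_(l < d, j < m) generic_var F l (e j)) 0 x | x < d * m].
pose down := [tuple mxvec (\matrix_(l < d, j < N)
  (if [pick i | e i == j] is Some i then generic_var F l i else 0)) 0 x | x < d * N].
have upX l j : generic_var F l j \mPo up = generic_var F l (e j).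
  by rewrite comp_mpolyXU -tnth_nth tnth_mktuple mxvecE mxE.
have downX l j : generic_var F l (e j) \mPo down = generic_var F l j.
  rewrite comp_mpolyXU -tnth_nth tnth_mktuple mxvecE mxE.
  by case: pickP => [i /eqP/inj_e->|/(_ j)]; rewrite ?eqxx.
have upK : cancel (comp_mpoly up) (comp_mpoly down).
  move=> p; rewrite [LHS](congr1 (comp_mpoly down \o comp_mpoly up) (mpolyE p)).
  rewrite [RHS]mpolyE /= (raddf_sum (comp_mpoly up)) (raddf_sum (comp_mpoly down)) /=.
  apply: eq_bigr => M _; rewrite !comp_mpolyZ; congr (_ *: _).
  rewrite mpolyXE_id (rmorph_prod (comp_mpoly up)) (rmorph_prod (comp_mpoly down)) /=.
  apply: eq_bigr => x _; rewrite !rmorphXn /=; congr (_ ^+ _).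
  by case/mxvec_indexP: x => l j; rewrite upX downX.
have [f fP] := fraction_rmorphism (can_inj upK).
by exists f => l j; rewrite !mxE fP /= upX.
Qed.

(** * Homology spheres and bistellar moves *)

Section Ridges.
Variables (F : fieldType) (T : finType) (e : nat) (D : {set {set T}}).
Hypotheses (sphereD : homology_sphere F e D) (pureD : pure_of_dim e D).

Lemma sphere_closed : down_closed D.
Proof. by case: pureD => -[]. Qed.

Lemma card_face (s : {set T}) : s \in D -> (#|s| <= e.+1)%N.
Proof.
move=> sD; have [M /pureD.2 <- sM] := @maxset_exists _ [pred u | u \in D] s sD.
exact: subset_leq_card.
Qed.

Lemma chains_support (L : {set {set T}}) k (f : {ffun {set T} -> F^o}) s :
  f \in chains F L k -> f s != 0 -> s \in L /\ #|s| = k.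
Proof.
rewrite /chains; set X := map _ _ => /(@coord_span _ _ _ (in_tuple X)) ->.
rewrite sum_ffunE => /eqP nz; apply: NNPP => nsL; apply: nz.
rewrite big1 // => i _; rewrite ffunE.
have /mapP[x] : X`_i \in X by rewrite mem_nth.
rewrite mem_filter mem_enum => /andP[/eqP cx xL] ->.
by rewrite ffunE; case: eqP => [sx|_]; [case: nsL; rewrite sx | rewrite scaler0].
Qed.

Lemma mem_chains (L : {set {set T}}) k s : s \in L -> #|s| = k ->
  elementary_chain F s \in chains F L k.
Proof.
by move=> sL cs; rewrite memv_span // map_f // mem_filter mem_enum sL cs eqxx.
Qed.

Lemma chain_boundary_vertex (v : T) :
  chain_boundary (elementary_chain F [set v]) = elementary_chain F set0.
Proof.
apply/ffunP=> t; rewrite !ffunE; case: eqP => [->|/eqP t0].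
  rewrite (bigD1 v) ?inE //= big1 => [|w /andP[_ wv]].
    rewrite !ffunE setU0 eqxx addr0 (_ : [set w in set0 | _] = set0).
      by rewrite cards0 expr0 scale1r.
    by apply/setP=> w; rewrite !inE.
  by rewrite ffunE setU0 (inj_eq set1_inj) (negPf wv) scaler0.
rewrite big1 // => w wt; rewrite ffunE; case: eqP => [E|_]; last by rewrite scaler0.
have [x xt] := set0Pn _ t0; case/negP: wt.
have : w \in [set v] by rewrite -E setU11.
have : x \in [set v] by rewrite -E inE xt orbT.
by rewrite !inE => /eqP xv /eqP->; rewrite -xv.
Qed.

(** The link of a ridge is a 0-sphere: its reduced homology in degree 0 is the
    kernel of the augmentation on its set of points, of dimension one less than
    the number of points, so there are two of them. *)
Lemma card_ridge (G : {set T}) : #|G| = e ->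
  ~~ odd #|[set H in D | (#|H| == e.+1) && (G \subset H)]|.
Proof.
move=> cG; pose X := [set v | (v \notin G) && (v |: G \in D)].
have -> : [set H in D | (#|H| == e.+1) && (G \subset H)] = [set v |: G | v in X].
  apply/setP=> H; rewrite inE; apply/and3P/imsetP => [[HD /eqP cH GH]|[v]].
    have /cards1P[v Hv] : #|H :\: G| == 1%N by rewrite cardsDS // cH cG subSnn.
    have vH : (v \notin G) && (v \in H) by have := set11 v; rewrite -Hv inE.
    have defH : H = v |: G.
      rewrite -Hv; apply/setP=> x; rewrite !inE.
      by case: (boolP (x \in G)) => [/(subsetP GH)->|]; rewrite ?orbT ?orbF.
    by exists v; rewrite // inE -defH HD andbT; case/andP: vH.
  rewrite inE => /andP[vG vD] ->; rewrite vD cardsU1 vG cG add1n eqxx.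
  by rewrite subsetUr.
rewrite card_in_imset => [|v w]; last first.
  rewrite !inE => /andP[vG _] /andP[wG _] E; have : v \in w |: G by rewrite -E setU11.
  by rewrite !inE (negPf vG) orbF => /eqP.
case: (set_0Vmem X) => [->|[x xX]]; first by rewrite cards0.
have GD : G \in D.
  by move: xX; rewrite inE => /andP[_ /sphere_closed]; apply; apply: subsetUr.
set L := link D G; have LX v : ([set v] \in L) = (v \in X).
  rewrite !inE; case: (boolP (v \in G)) => vG /=.
    have -> : ([set v] :&: G == set0) = false.
      by apply/negbTE/set0Pn; exists v; rewrite !inE eqxx.
    by rewrite !andbF.
  have -> : [set v] :&: G == set0.
    by apply/eqP/setP=> w; rewrite !inE; case: eqP => // ->; rewrite (negPf vG).
  rewrite andbT; case: (boolP (v |: G \in D)) => vD; rewrite ?andbF //.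
  by rewrite (sphere_closed vD) // sub1set setU11.
have B0 : boundaries F L 1 = 0%VS.
  rewrite /boundaries /chains (_ : [seq s : {set T} <- enum L | #|s| == 2] = [::]).
    by rewrite span_nil limg0.
  apply/eqP; rewrite -size_eq0 size_filter -leqn0 leqNgt -has_count.
  apply/hasPn => s; rewrite mem_enum !inE => /and3P[_ sD /eqP sG].
  have := card_face sD; rewrite cardsU sG cards0 subn0 cG => le.
  by apply/eqP=> cs; rewrite cs ltnn in le.
have dimZ : \dim (cycles F L 1) = 1%N.
  have := sphereD.2 G GD 1%N; rewrite /reduced_betti B0 dimv0 subn0 => ->.
  by rewrite cG eqxx.
have cycleP f : f \in cycles F L 1 <->
    f \in chains F L 1 /\ chain_boundary f = 0.
  rewrite memv_cap memv_ker lfunE; split=> [/andP[? /eqP]|[-> E]] //.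
  exact/eqP.
pose dif (v w : T) := elementary_chain F [set v] - elementary_chain F [set w].
have difZ (v w : T) : v \in X -> w \in X -> dif v w \in cycles F L 1.
  move=> vX wX; apply/cycleP; split.
    by rewrite rpredB // mem_chains ?cards1 ?LX.
  by rewrite raddfB /= !chain_boundary_vertex subrr.
have difE (v w y : T) : dif v w [set y] = (y == v)%:R - (y == w)%:R.
  by rewrite !ffunE !(inj_eq set1_inj).
have [v [w [vX wX vw]]] : exists v : T, exists w : T, [/\ v \in X, w \in X & v != w].
  pose f := vpick (cycles F L 1).
  have f0 : f != 0 by rewrite vpick0 -dimv_eq0 dimZ.
  have /cycleP[fch df] : f \in cycles F L 1 by apply: memv_pick.
  have /existsP[s fs] : [exists s, f s != 0].
    apply: contraNT f0; rewrite negb_exists => /forallP z.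
    by apply/eqP/ffunP=> s; rewrite ffunE; apply/eqP/negbNE.
  have [sL /eqP/cards1P[v sv]] := chains_support fch fs.
  have : \sum_(y : T) f [set y] = 0.
    have /ffunP/(_ set0) := df; rewrite !ffunE => E0; rewrite -[RHS]E0.
    apply: eq_big => [y|y _]; first by rewrite inE.
    rewrite setU0 (_ : [set w in set0 | _] = set0).
      by rewrite cards0 expr0 scale1r.
    by apply/setP=> z; rewrite !inE.
  rewrite (bigD1 v) //= => E; have /existsP[w /andP[wv fw]] :
      [exists w, (w != v) && (f [set w] != 0)].
    apply: contraNT fs; rewrite negb_exists => /forallP z; rewrite sv.
    move: E; rewrite big1 ?addr0 => [->//|w wv].
    by have := z w; rewrite wv => /negbNE/eqP.
  exists v, w; rewrite -!LX -sv sL eq_sym wv; split=> //.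
  by have [] := chains_support fch fw.
suff -> : X = [set v; w] by rewrite cards2 vw.
apply/setP=> u; rewrite in_set2.
apply/idP/idP => [uX|/orP[/eqP->|/eqP->]] //; apply: contraTT isT.
rewrite negb_or => /andP[uv uw]; exfalso.
have Zline : cycles F L 1 = <[dif v w]>%VS.
  apply/eqP; rewrite eq_sym eqEdim dimZ dim_vline; apply/andP; split.
    by rewrite -memvE difZ.
  case: eqP => // /ffunP/(_ [set v]) /eqP; rewrite difE ffunE eqxx (negPf vw).
  by rewrite subr0 oner_eq0.
have : dif v u \in cycles F L 1 by apply: difZ.
rewrite Zline => /vlineP[k /ffunP E]; have /eqP := E [set u].
rewrite difE [X in _ == X]ffunE difE (negPf uv) (negPf uw) eqxx subrr scaler0 sub0r.
by rewrite oppr_eq0 oner_eq0.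
Qed.

End Ridges.

Section BistellarMove.
Variables (T : finType) (e q : nat) (D : {set {set T}}) (s t : {set T}).
Hypothesis move : is_bistellar_move e q D s t.
Let D' := bistellar_flip D s t.

Lemma move_closed : down_closed D.
Proof. by case: (bm_pure move) => -[]. Qed.

Lemma move_disjoint v : v \in s -> v \in t -> False.
Proof.
move=> vs vt; have vD : [set v] \in D.
  by apply: move_closed (bm_face move) _; rewrite sub1set.
have ct := bm_card_new move; have := bm_vertices move.
case: (posnP q) => [_|q0 _].
  by move/disjoint_setI0/setP/(_ v); rewrite !inE vt vD.
have : [set v] \in link D s.
  by rewrite (bm_link move) inE properEcard sub1set vt cards1 ct ltnS.
rewrite inE => /and3P[_ _ /eqP/setP/(_ v)].
by rewrite !inE eqxx vs.
Qed.

Lemma mem_star_move (u : {set T}) : u \in D -> (u :|: s \in D) = (u :\: s \proper t).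
Proof.
move=> uD; have -> : u :\: s \proper t = (u :\: s \in link D s).
  by rewrite (bm_link move) inE.
rewrite inE (move_closed uD (subsetDl u s)) /=.
have -> : u :\: s :|: s = u :|: s.
  by apply/setP=> x; rewrite !inE; case: (x \in s); rewrite ?orbT ?orbF.
have -> : (u :\: s) :&: s == set0.
  by apply/eqP/setP=> x; rewrite !inE; case: (x \in s); rewrite ?andbF.
by rewrite andbT.
Qed.

Lemma mem_move_sup (u : {set T}) : s \subset u -> (u \in D) = (u :\: s \proper t).
Proof.
move=> su; have us : u :|: s = u by apply/setUidPl.
apply/idP/idP => [uD|]; first by rewrite -mem_star_move ?us.
have -> : u :\: s \proper t = (u :\: s \in link D s).
  by rewrite (bm_link move) inE.
rewrite inE => /and3P[_ + _].
have -> // : u :\: s :|: s = u.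
apply/setP=> x; rewrite !inE.
by case: (boolP (x \in s)) => [/(subsetP su)->|]; rewrite ?orbT ?orbF.
Qed.

Lemma mem_bistellar_flip (u : {set T}) : (u \in D') =
  ((u \in D) && ~~ (u :\: s \proper t)) || ((u \subset s :|: t) && ~~ (s \subset u)).
Proof.
rewrite inE; congr (_ || _).
  rewrite !inE; case: (boolP (u \in D)) => uD; last by rewrite andbF.
  by rewrite mem_star_move //= andbC.
apply/imset2P/andP => [[x y]|[ust sNu]].
  rewrite !inE => /andP[xs sx] yt ->; split; first exact: setUSS.
  apply: contra sx => sxy; apply/subsetP => v vs.
  have := subsetP sxy v vs; rewrite inE => /orP[//|/(subsetP yt) vt].
  by case: (move_disjoint vs vt).
exists (u :&: s) (u :\: s); last by rewrite setID.
  rewrite inE properE subsetIr /=; apply: contra sNu => /subset_trans; apply.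
  exact: subsetIl.
by rewrite inE subDset.
Qed.

Lemma half_flip_move : half_flip D D' s t.
Proof.
split.
- exact: move_closed.
- exact: bm_nonface move.
- move=> v; rewrite inE negb_or => /andP[vs vt].
  rewrite mem_move_sup ?subsetUr //; apply: contra vt => /proper_sub/subsetP; apply.
  by rewrite !inE vs eqxx.
move=> u uD' sNu; have Nst : ~~ (u \subset s :|: t).
  by apply: contra uD' => ust; rewrite mem_bistellar_flip ust sNu orbT.
rewrite Nst andbT; apply: contra uD' => uD; rewrite mem_bistellar_flip uD /=.
case: (boolP (_ \proper _)) => //= /proper_sub; rewrite subDset => ust.
by rewrite ust in Nst.
Qed.

Lemma bistellar_flip_closed : down_closed D'.
Proof.
move=> u w; rewrite !mem_bistellar_flip => /orP[/andP[uD uNt]|/andP[ust sNu]] wu.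
  have wD := move_closed uD wu; rewrite wD /=.
  case: (boolP (_ \proper _)) => //= pwt.
  rewrite -subDset proper_sub //=; apply: contra uNt => sw.
  by rewrite -mem_star_move // (setUidPl (subset_trans sw wu)).
rewrite (subset_trans wu ust) /=; apply/orP; right.
by apply: contra sNu => /subset_trans; apply.
Qed.

Lemma half_flip_move_inv : half_flip D' D t s.
Proof.
have t0 : set0 \proper t.
  by rewrite proper0 -cards_eq0 (bm_card_new move).
split.
- exact: bistellar_flip_closed.
- by rewrite mem_bistellar_flip setDv t0 andbF subxx andbF.
- move=> v; rewrite inE negb_or => /andP[vt vs].
  rewrite mem_bistellar_flip negb_or; apply/andP; split.
    apply/negP => /andP[/move_closed/(_ (subsetUr _ _))].
    by rewrite (negPf (bm_nonface move)).
  apply/negP=> /andP[/subsetP/(_ v)]; rewrite !inE eqxx (negPf vs) (negPf vt).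
  by move/(_ isT).
move=> u uD tNu.
have Nst : ~~ (u \subset t :|: s).
  apply: contra uD => ust; have : u :|: s \in D.
    rewrite mem_move_sup ?subsetUr // properE subDset.
    rewrite subUset subsetUl setUC ust /=; apply: contra tNu => tu.
    apply: subset_trans tu _; apply/subsetP=> x; rewrite !inE.
    by move=> /andP[/negPf->]; rewrite orbF.
  by move/move_closed; apply; apply: subsetUl.
rewrite Nst andbT mem_bistellar_flip (negPf uD) /=.
by rewrite setUC (negPf Nst).
Qed.

(** Any facet in the star of [s]; it witnesses that the top class of [s] is not
    zero. *)
Lemma move_facet : exists F : {set T}, [/\ F \in D, s \subset F & #|F| = e.+1].
Proof.
have ct := bm_card_new move.
have [w wt] : exists w, w \in t by apply/set0Pn; rewrite -cards_eq0 ct.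
exists (s :|: t :\ w).
have sF : s \subset s :|: t :\ w by apply: subsetUl.
have dis : s :&: t = set0.
  apply/eqP; rewrite -subset0; apply/subsetP=> v; rewrite inE => /andP[vs vt].
  by case: (move_disjoint vs vt).
split=> //.
- rewrite mem_move_sup // setDUl setDv set0U.
  apply: sub_proper_trans (subsetDl _ _) _; exact: properD1.
- rewrite cardsU setIDA dis set0D cards0 subn0 -(bm_card_face move).
  by have := cardsD1 w t; rewrite wt ct => -[->].
Qed.

End BistellarMove.

(** * Invariance of generic anisotropy *)

Section FlipInvariance.
Variables (K : fieldType) (charK : (2 \in [pchar K])%R).
Variables (N d : nat) (a : 'M[K]_(d, N)) (gp : general_position a).
Variables (D D' : {set {set 'I_N}}) (s t : {set 'I_N}) (o : 'I_N).
Hypotheses (flip : half_flip D D' s t) (flip' : half_flip D' D t s).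
Hypotheses (card_st : (#|s| + #|t|)%N = d.+1) (card_A : #|s :|: t| = d.+1).
Hypotheses (s_gt0 : (0 < #|s|)%N) (t_gt0 : (0 < #|t|)%N) (dN : (d < N)%N).
Hypothesis oD : forall u : {set 'I_N}, u \in D -> o \notin u.
Hypothesis ridges : forall G : {set 'I_N}, #|G|.+1 = d ->
  ~~ odd #|[set F in D | (#|F| == d) && (G \subset F)]|.
Variable F : {set 'I_N}.
Hypotheses (FD : F \in D) (sF : s \subset F) (cF : #|F| = d).

Lemma nondegenerate_flip_iff i : (i <= d)%N ->
  nondegenerate_in D (matrix_forms a) i <-> nondegenerate_in D' (matrix_forms a) i.
Proof.
move=> id; pose A := s :|: t; pose lam := dependency a A.
have lam_out v : v \notin A -> lam v = 0.
  by rewrite /lam /dependency => /negPf->.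
have lam_in v : v \in A -> lam v != 0 by apply: dependency_neq0.
have lam_dep l : \sum_j a l j * lam j = 0 by apply: dependency_sum.
have dual v w : v \in A -> w \in A -> v != w ->
  exists c : 'rV_d, (c *m a) 0 v = 1 /\
    forall u, u \in A -> u != v -> u != w -> (c *m a) 0 u = 0.
  move=> vA wA vw; have cAw : #|A :\ w| = d.
    by have := cardsD1 w A; rewrite wA [#|A|]card_A => -[].
  have vAw : v \in A :\ w by rewrite in_setD1 vw vA.
  have [c [cv cu]] := dual_vector charK gp cAw vAw.
  by exists c; split=> // u uA uv uw; apply: cu => //; rewrite in_setD1 uw.
have [v0 v0s] : exists v0, v0 \in s by apply/set0Pn; rewrite -card_gt0.
have v0A : v0 \in A by rewrite inE v0s.
have defA' : A = t :|: s by rewrite setUC.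
have nz_s : ~ reduction_ideal D (matrix_forms a) (star_class lam v0 s d).
  move=> Iz; apply: (facet_notin_reduction charK gp (hf_closed flip) oD dN ridges FD cF).
  have linkD v : v \notin A -> v |: s \notin D by apply: hf_link flip v.
  have := @star_class_mod _ _ _ a A lam lam_out lam_in lam_dep dual v0 v0A D s
    (subsetUl _ _) linkD d (squarefree_mnm F).
  rewrite mdeg_squarefree mnm_support_squarefree => /(_ cF sF) E.
  have := reductionD E (reductionZ 'X_[squarefree_mnm F].@[lam] Iz).
  by rewrite subrK.
have nz_t : ~ reduction_ideal D' (matrix_forms a) (star_class lam v0 t d).
  move=> Iz; apply: nz_s.
  exact: (top_class_flip lam_out lam_in lam_dep dual v0A (erefl A) flip flip'
    card_st s_gt0 t_gt0).
split.
  exact: (nondegenerate_flip lam_out lam_in lam_dep dual v0A (erefl A) flip flip'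
    card_st t_gt0).
have card_ts : (#|t| + #|s|)%N = d.+1 by rewrite addnC.
exact: (nondegenerate_flip lam_out lam_in lam_dep dual v0A defA' flip' flip
  card_ts s_gt0).
Qed.

End FlipInvariance.

Section PushForward.
Variables (T : finType) (N : nat) (e : T -> 'I_N) (inj_e : injective e).

Definition push_complex (D : {set {set T}}) : {set {set 'I_N}} :=
  [set u : {set 'I_N} | (u \subset codom e) && (e @^-1: u \in D)].

Lemma preimset_imset (u : {set T}) : e @^-1: (e @: u) = u.
Proof. by apply/setP=> v; rewrite inE mem_imset. Qed.

Lemma imset_preimset (u : {set 'I_N}) : u \subset codom e -> e @: (e @^-1: u) = u.
Proof.
move/subsetP=> ue; apply/setP=> j; apply/imsetP/idP => [[v]|ju].
  by rewrite inE => ? ->.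
by have /codomP[v jv] := ue _ ju; exists v; rewrite // inE -jv.
Qed.

Lemma imset_codom (u : {set T}) : e @: u \subset codom e.
Proof. by apply/subsetP=> j /imsetP[v _ ->]; apply: codom_f. Qed.

Lemma mem_push_imset D (u : {set T}) : (e @: u \in push_complex D) = (u \in D).
Proof. by rewrite inE imset_codom preimset_imset. Qed.

Lemma subset_imset (u w : {set T}) : (e @: u \subset e @: w) = (u \subset w).
Proof.
apply/idP/idP => [|/imsetS//]; move/(preimsetS e).
by rewrite !preimset_imset.
Qed.

Lemma push_closed D : down_closed D -> down_closed (push_complex D).
Proof.
move=> Dc u w; rewrite !inE => /andP[ue uD] wu; apply/andP; split.
  by apply/subsetP=> j /(subsetP wu)/(subsetP ue).
exact: Dc uD (preimsetS _ wu).
Qed.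

Lemma push_half_flip D D' s t : half_flip D D' s t ->
  half_flip (push_complex D) (push_complex D') (e @: s) (e @: t).
Proof.
move=> flip; split.
- exact/push_closed/(hf_closed flip).
- by rewrite mem_push_imset (hf_new flip).
- move=> j jst; rewrite inE; apply/negP => /andP[/subsetP/(_ j)].
  rewrite setU11 => /(_ isT)/codomP[v jv]; subst j.
  rewrite -imsetU1 preimset_imset; apply/negP/(hf_link flip).
  by apply: contra jst; rewrite -imsetU mem_imset.
move=> u; rewrite !inE; case: (boolP (u \subset codom e)) => ue /=; last first.
  move=> _ _; apply: contra ue => ust; apply/subsetP => j /(subsetP ust).
  by rewrite -imsetU => /imsetP[v _ ->]; apply: codom_f.
rewrite -{2 4}(imset_preimset ue) -imsetU !subset_imset.
exact: (hf_outside flip).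
Qed.

Lemma push_ridges (D : {set {set T}}) d :
  (forall G : {set T}, #|G|.+1 = d ->
    ~~ odd #|[set F in D | (#|F| == d) && (G \subset F)]|) ->
  forall G : {set 'I_N}, #|G|.+1 = d ->
    ~~ odd #|[set F in push_complex D | (#|F| == d) && (G \subset F)]|.
Proof.
move=> ridges G cG; case: (boolP (G \subset codom e)) => Ge; last first.
  rewrite (_ : [set F in _ | _] = set0) ?cards0 //; apply/setP=> F; rewrite !inE.
  apply/negP => /and3P[/andP[Fe _] _ GF]; case/negP: Ge.
  by apply/subsetP=> j /(subsetP GF)/(subsetP Fe).
have cG' : #|e @^-1: G|.+1 = d by rewrite -(card_imset _ inj_e) imset_preimset.
have := ridges _ cG'; rewrite -(card_imset _ (imset_inj inj_e)).
congr (~~ odd #|pred_of_set _|); apply/setP=> F; apply/imsetP/idP => [[H]|].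
  rewrite !inE => /and3P[HD /eqP cH GH] ->.
  rewrite imset_codom preimset_imset HD card_imset // cH eqxx /=.
  by rewrite -(imset_preimset Ge) subset_imset.
rewrite inE => /and3P[]; rewrite inE => /andP[Fe FD] /eqP cF GF.
exists (e @^-1: F); last by rewrite imset_preimset.
by rewrite inE FD -(card_imset _ inj_e) imset_preimset // cF eqxx preimsetS.
Qed.

End PushForward.

(** The reduction over the field of the matrix indexed by the vertices of [D] is
    compared with the one over a larger field, which is common to the complexes
    with vertices in [T]. Nondegeneracy ascends to the larger field and anisotropy
    descends from it. *)
Section GenericBridge.
Variables (F : fieldType) (T : finType) (n N : nat).
Variables (e : T -> 'I_N) (inj_e : injective e) (D : {set {set T}}).
Hypothesis Dc : down_closed D.
Local Notation m := #|vertices D|.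
Local Notation d := (2 * n)%N.
Local Notation thetaN := (matrix_forms (generic_mx F d N)).

Lemma reduction_ideal_ext (K : fieldType) k l (E : {set {set 'I_k}})
    (th th' : 'I_l -> {mpoly K[k]}) p :
  th =1 th' -> reduction_ideal E th p -> reduction_ideal E th' p.
Proof.
by move=> Eth [b H]; exists b; under eq_bigr do rewrite -Eth.
Qed.

Lemma anisotropic_ext (K : fieldType) k l (E : {set {set 'I_k}})
    (th th' : 'I_l -> {mpoly K[k]}) :
  th =1 th' -> anisotropic E th -> anisotropic E th'.
Proof.
move=> Eth an i p id hp nIp Ip2; have Eth' : th' =1 th by move=> j; rewrite Eth.
apply: (an i p id hp); last exact: reduction_ideal_ext Eth' Ip2.
by move=> Ip; apply: nIp; apply: reduction_ideal_ext Eth Ip.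
Qed.

Let vtx (j : 'I_m) : T := enum_val j.

Lemma generic_thetaE l : @generic_theta F T d D l = matrix_forms (generic_mx F d m) l.
Proof. by apply: eq_bigr => j _; rewrite mxE. Qed.

Lemma generically_anisotropicE : generically_anisotropic F d D <->
  anisotropic (relabel D) (matrix_forms (generic_mx F d m)).
Proof.
split; first exact: (anisotropic_ext generic_thetaE).
by apply: anisotropic_ext => l; rewrite generic_thetaE.
Qed.

Lemma relabel_closed : down_closed (relabel D).
Proof. by move=> u w; rewrite !inE => uD wu; apply: Dc uD (imsetS _ wu). Qed.

Let ev (j : 'I_m) := e (vtx j).

Let inj_ev : injective ev.
Proof. by move=> i j /inj_e/enum_val_inj. Qed.

Let relabel_push (u : {set 'I_m}) :
  (u \in relabel D) = (ev @: u \in push_complex e D).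
Proof. by rewrite (imset_comp e vtx) mem_push_imset // inE. Qed.

Let push_im (u : {set 'I_N}) : u \in push_complex e D -> u \subset codom ev.
Proof.
rewrite inE => /andP[/subsetP ue uD]; apply/subsetP=> j ju.
have /codomP[v jv] := ue j ju; have vD : v \in vertices D.
  by rewrite inE; apply: Dc uD _; rewrite sub1set inE -jv.
apply/codomP; exists (enum_rank_in vD v).
by rewrite /ev /vtx enum_rankK_in.
Qed.

Lemma generically_anisotropic_nondegenerate i :
  generically_anisotropic F d D -> (0 < i <= n)%N ->
  nondegenerate_in (push_complex e D) thetaN i.
Proof.
move=> /generically_anisotropicE an id.
have nd := anisotropic_nondegenerate an id.
have [f fP] := generic_field_embedding F d inj_ev.
have id' : (0 < i <= d)%N.
  by case/andP: id => -> /leq_trans-> //; rewrite leq_pmull.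
have /(nondegenerate_field_extension f relabel_closed (generic_mx F d m) id') := nd.
apply: (nondegenerate_renaming inj_ev _ relabel_push push_im).
by move=> l j; rewrite mxE fP.
Qed.

Lemma anisotropic_generically : anisotropic (push_complex e D) thetaN ->
  generically_anisotropic F d D.
Proof.
move=> an; apply/generically_anisotropicE => i p id hp nIp Ip2.
case: (posnP i) hp => [->|i0] hp.
  by apply: nIp; apply: reduction_sqr_const.
have [f fP] := generic_field_embedding F d inj_ev.
have ab l j : map_mx f (generic_mx F d m) l j = generic_mx F d N l (ev j).
  by rewrite mxE fP.
have upP := rename_up_reductionP inj_ev ab relabel_push push_im.
have extP := reduction_field_extension f relabel_closed (generic_mx F d m).
apply: (an i (rename_up ev (map_mpoly f p)) id).
- by apply/rename_up_homog/homog_map_mpoly.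
- by move/upP/(extP i p i0 hp).
have hp2 : p ^+ 2 \is (i * 2).-homog by apply: dhomogMn.
have i2 : (0 < i * 2)%N by rewrite muln_gt0 i0.
by rewrite -!rmorphXn; apply/upP/(extP _ _ i2 hp2).
Qed.

End GenericBridge.

Local Close Scope ring_scope.

Theorem theorem4p1 (F : fieldType) (charF : (2 \in [pchar F])%R)
    (n : nat) (n_ge1 : (1 <= n)%N) (T : finType) (D D' : {set {set T}})
    (sphereD : homology_sphere F (2 * n - 1) D)
    (q : nat) (q_le : (q <= 2 * n - 1)%N)
    (moveD : bistellar_move (2 * n - 1) q D D') :
  generically_anisotropic F (2 * n) D <-> generically_anisotropic F (2 * n) D'.
Proof.
have [s [t [move ->]]] := moveD.
have d_gt0 : (0 < 2 * n)%N by rewrite muln_gt0.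
have dE : (2 * n - 1).+1 = (2 * n)%N by rewrite subn1 prednK.
(* One more column than [T] has elements: the apex of the fundamental class. *)
pose e (v : T) := lift ord_max (enum_rank v); pose o : 'I_#|T|.+1 := ord_max.
have inj_e : injective e by move=> v w /lift_inj/enum_rank_inj.
have oe (u : {set T}) : e @: u \subset [set~ o].
  by apply/subsetP=> j /imsetP[v _ ->]; rewrite !inE eq_sym neq_lift.
have flip := push_half_flip inj_e (half_flip_move move).
have flip' := push_half_flip inj_e (half_flip_move_inv move).
have cs : #|e @: s| = #|s| by apply: card_imset.
have ct : #|e @: t| = q.+1 by rewrite card_imset // (bm_card_new move).
have s_gt0 : (0 < #|s|)%N.
  by rewrite -(ltn_add2r q) (bm_card_face move) add0n ltnS.
have card_st : (#|e @: s| + #|e @: t|)%N = (2 * n).+1.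
  by rewrite cs ct addnS (bm_card_face move) dE.
have card_A : #|e @: s :|: e @: t| = (2 * n).+1.
  rewrite cardsU card_st (_ : _ :&: _ = set0) ?cards0 ?subn0 //.
  apply/setP=> j; rewrite !inE; apply/negP => /andP[/imsetP[v vs ->]].
  by rewrite mem_imset // => vt; apply: (move_disjoint move vs vt).
have [Fc [FD sF cF]] := move_facet move.
have dN : (2 * n < #|T|.+1)%N by rewrite ltnS -dE -cF max_card.
have oD (u : {set 'I_#|T|.+1}) : u \in push_complex e D -> o \notin u.
  rewrite inE => /andP[ue _]; rewrite -(imset_preimset ue).
  by apply/negP => /(subsetP (oe _)); rewrite !inE eqxx.
have ridges : forall G : {set T}, #|G|.+1 = (2 * n)%N ->
    ~~ odd #|[set H in D | (#|H| == (2 * n)%N) && (G \subset H)]|.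
  by move=> G; rewrite -dE => -[cG]; apply: (card_ridge sphereD (bm_pure move)).
have gp := @generic_general_position F (2 * n) #|T|.+1.
have charK := @generic_pchar F (2 * n) #|T|.+1 charF.
have iff i : (i <= 2 * n)%N ->
    nondegenerate_in (push_complex e D) (matrix_forms (generic_mx F (2 * n) #|T|.+1)) i
    <-> nondegenerate_in (push_complex e (bistellar_flip D s t))
          (matrix_forms (generic_mx F (2 * n) #|T|.+1)) i.
  apply: (@nondegenerate_flip_iff _ charK _ _ _ gp _ _ _ _ o flip flip' card_st card_A
    _ _ dN oD (push_ridges inj_e ridges) (e @: Fc)).
  - by rewrite cs.
  - by rewrite ct.
  - by rewrite mem_push_imset.
  - exact: imsetS.
  - by rewrite card_imset // cF dE.
have Dc := move_closed move; have Dc' := bistellar_flip_closed move.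
have half i : (0 < i)%N -> (2 * i <= 2 * n)%N -> (0 < i <= n)%N /\ (i <= 2 * n)%N.
  rewrite leq_mul2l /= => -> i2; rewrite i2; split=> //.
  by apply: leq_trans i2 _; rewrite leq_pmull.
have ind := @generic_square_independent F (2 * n) #|T|.+1 charF.
split=> an; apply: (anisotropic_generically inj_e) => //.
  apply: (nondegenerate_anisotropic charK) => //.
    exact: push_closed.
  move=> i i0 /(half i i0)[id id2]; apply/iff => //.
  exact: generically_anisotropic_nondegenerate.
apply: (nondegenerate_anisotropic charK) => //; first exact: push_closed.
move=> i i0 /(half i i0)[id id2]; apply/iff => //.
exact: generically_anisotropic_nondegenerate.
Qed.
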